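(* Let $k$ be a field (of arbitrary characteristic), let $m\geqslant 1$ and $d>1$ be integers, and let $F, F' \in k[T_1,\ldots,T_m,V]$ be the polynomials $$F= a_0+a_1 V+\cdots + a_{d-1}V^{d-1} + V^d, \qquad F'= a_1+ 2a_2V+ \cdots + (d-1)a_{d-1} V^{d-2} + d V^{d-1},$$ for some $a_i \in k[T_1,\ldots,T_m]$, $0 \leqslant i \leqslant d-1$. For $\underline{r}=(r_1,\ldots,r_m)\in \mathbb{Z}^m_{\geqslant 1}$ put $$B_{\underline{r}} := \frac{k[T_1,\ldots,T_m,U,V]}{(T_1^{r_1}\cdots T_m^{r_m}U-F(T_1,\ldots,T_m,V))}.$$ Then the following statements hold: (i) Suppose that either of the following conditions holds: (a) $\underline{r} \in \mathbb{Z}^m_{>1}$ and $\underline{s} \in \mathbb{Z}^m_{\geqslant 1} \setminus \mathbb{Z}^m_{>1}$; (b) $\underline{r}, \underline{s} \in \mathbb{Z}^m_{>1}$ are such that $\underline{r}=(r_1,\ldots,r_m)$ and $\underline{s}=(s_1,\ldots,s_m)$ are not permutations of each other. Then $B_{\underline{r}}$ and $B_{\underline{s}}$ are not isomorphic as $k$-algebras. (ii) If the ideal $(F,F')$ of $k[T_1,\ldots,T_m,V]$ is the whole ring $k[T_1,\ldots,T_m,V]$, then $B_{\underline{r}}^{[1]} \cong_k B_{\underline{s}}^{[1]}$ for all $\underline{r}, \underline{s} \in \mathbb{Z}^m_{\geqslant 1}$.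
   Context: For a ring $R$, $R^{[n]}$ denotes a polynomial ring in $n$ variables over $R$. $\mathbb{Z}^m_{>1}$ (resp. $\mathbb{Z}^m_{\geqslant 1}$) is the set of $m$-tuples of integers all of whose entries are $>1$ (resp. $\geqslant 1$). $\cong_k$ means isomorphic as $k$-algebras. $T_1,\dots,T_m,U,V$ are indeterminates. *)

(* Defs.v *)
From HB Require Import structures.
From mathcomp Require Import all_boot all_algebra ring_quotient.
From mathcomp Require Export mpoly.
From mathcomp Require boolp.

Set Implicit Arguments.
Unset Strict Implicit.
Unset Printing Implicit Defensive.

Import GRing.Theory.
Local Open Scope ring_scope.
Local Open Scope quotient_scope.

Definition alg_isomorphic (k : nzRingType) (A B : algType k) : Prop :=
  exists f : {lrmorphism A -> B}, bijective f.

Definition generate_unit_ideal (R : comNzRingType) (f g : R) : Prop :=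
  forall h : R, exists u v : R, h = u * f + v * g.

(* [{poly A}] only carries the structure of an [A]-algebra in the library.    *)
(* [poly1 A] is a copy of it, as an algebra over the ground ring [k] of [A].  *)
Definition poly1 (k : nzRingType) (A : comAlgType k) := {poly A}.

Section Poly1.
Variables (k : nzRingType) (A : comAlgType k).

HB.instance Definition _ := GRing.ComNzRing.on (poly1 A).

Definition poly1_scale (c : k) (p : poly1 A) : poly1 A := (c%:A : A)%:P * p.

Fact poly1_scaleA c d p :
  poly1_scale c (poly1_scale d p) = poly1_scale (c * d) p.
Proof. by rewrite /poly1_scale mulrA -polyCM -scalerAl mul1r scalerA. Qed.

Fact poly1_scale1 : left_id 1 poly1_scale.
Proof. by move=> p; rewrite /poly1_scale scale1r mul1r. Qed.

Fact poly1_scaleDr : right_distributive poly1_scale +%R.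
Proof. by move=> c p q; rewrite /poly1_scale mulrDr. Qed.

Fact poly1_scaleDl p : {morph poly1_scale^~ p : c d / c + d}.
Proof. by move=> c d; rewrite /poly1_scale scalerDl polyCD mulrDl. Qed.

HB.instance Definition _ := GRing.Zmodule_isLmodule.Build k (poly1 A)
  poly1_scaleA poly1_scale1 poly1_scaleDr poly1_scaleDl.

Fact poly1_scaleAl (c : k) (p q : poly1 A) : c *: (p * q) = c *: p * q.
Proof. exact: mulrA. Qed.

HB.instance Definition _ :=
  GRing.Lmodule_isLalgebra.Build k (poly1 A) poly1_scaleAl.
HB.instance Definition _ :=
  GRing.Lalgebra_isComAlgebra.Build k (poly1 A).
End Poly1.

(* In [{mpoly k[m.+1]}] the variables are T_1, ..., T_m, V in this order; in  *)
(* [{mpoly k[m.+2]}] they are T_1, ..., T_m, V, U.                            *)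
Section Danielewski.
Variables (k : fieldType) (m d : nat) (a : 'I_d -> {mpoly k[m]}).

Definition polyF : {mpoly k[m.+1]} :=
  \sum_(i < d) mwiden (a i) * 'X_ord_max ^+ i + 'X_ord_max ^+ d.

Definition polyF' : {mpoly k[m.+1]} :=
  \sum_(i < d) i%:R * mwiden (a i) * 'X_ord_max ^+ i.-1
  + d%:R * 'X_ord_max ^+ d.-1.

Variable r : m.-tuple nat.

Definition monoT : {mpoly k[m]} := \prod_(i < m) 'X_i ^+ tnth r i.

Definition relB : {mpoly k[m.+2]} :=
  mwiden (mwiden monoT) * 'X_ord_max - mwiden polyF.

Definition idealB : {pred {mpoly k[m.+2]}} :=
  fun p => boolp.asbool (exists q, p = q * relB).

Fact meval_mwiden n (p : {mpoly k[n]}) (v : 'I_n.+1 -> k) :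
  (mwiden p).@[v] = p.@[fun i => v (widen_ord (leqnSn n) i)].
Proof.
rewrite [p in LHS]mpolyE (big_morph _ (@mwidenD _ _) (@mwiden0 _ _)).
rewrite raddf_sum /= [RHS]mevalE; apply: eq_bigr => e _.
rewrite mwidenZ mwidenX mevalZ mevalX big_ord_recr /= mnmwiden_ordmax.
by rewrite expr0 mulr1; under eq_bigr do rewrite mnmwiden_widen.
Qed.

(* The ideal is proper because [relB] vanishes at some k-point with all T_i   *)
(* equal to 1 and V equal to 0.                                               *)
Fact relB_root : exists v : 'I_m.+2 -> k, relB.@[v] = 0.
Proof.
pose t (i : 'I_m.+1) : k := if i == ord_max then 0 else 1.
pose w (i : 'I_m.+2) : k :=
  if unlift ord_max i is Some j then t j else polyF.@[t].
have wE i : w (widen_ord (leqnSn m.+1) i) = t i.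
  have -> : widen_ord (leqnSn m.+1) i = lift ord_max i.
    by apply: val_inj; rewrite /= /bump leqNgt ltn_ord.
  by rewrite /w liftK.
exists w; rewrite mevalB mevalM mevalXU !meval_mwiden {2}/w unlift_none.
rewrite (meval_eq polyF wE) rmorph_prod big1 /= ?mul1r ?subrr // => i _.
by rewrite rmorphXn /= mevalXU wE /t -val_eqE /= ltn_eqF // expr1n.
Qed.

Fact idealB_closed : idealr_closed idealB.
Proof.
split.
- by apply/boolp.asboolP; exists 0; rewrite mul0r.
- apply/negP => /boolp.asboolP [q e1]; have [v rv] := relB_root.
  have := congr1 (meval v) e1; rewrite meval1 mevalM rv mulr0.
  by move/eqP; rewrite oner_eq0.
move=> c x y /boolp.asboolP [p ->] /boolp.asboolP [q ->].
by apply/boolp.asboolP; exists (c * p + q); rewrite mulrDl mulrA.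
Qed.

HB.instance Definition _ :=
  isIdealr.Build {mpoly k[m.+2]} idealB idealB_closed.

Definition B := {ideal_quot idealB}.
HB.instance Definition _ := GRing.ComNzRing.on B.

Definition projB (p : {mpoly k[m.+2]}) : B := \pi_({ideal_quot idealB}) p.

Definition B_scale (c : k) (x : B) : B := projB c%:MP * x.

Fact projBM p q : projB (p * q) = projB p * projB q.
Proof. exact: rmorphM. Qed.

Fact B_scaleA c e x : B_scale c (B_scale e x) = B_scale (c * e) x.
Proof. by rewrite /B_scale mulrA -projBM -mpolyCM. Qed.

Fact B_scale1 : left_id 1 B_scale.
Proof.
move=> x; rewrite /B_scale mpolyC1.
by rewrite [projB 1](rmorph1 \pi_({ideal_quot idealB})) mul1r.
Qed.

Fact B_scaleDr : right_distributive B_scale +%R.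
Proof. by move=> c p q; rewrite /B_scale mulrDr. Qed.

Fact B_scaleDl x : {morph B_scale^~ x : c e / c + e}.
Proof.
move=> c e; rewrite /B_scale mpolyCD -mulrDl; congr (_ * _).
exact: (rmorphD \pi_({ideal_quot idealB})).
Qed.

HB.instance Definition _ := GRing.Zmodule_isLmodule.Build k B
  B_scaleA B_scale1 B_scaleDr B_scaleDl.

Fact B_scaleAl (c : k) (p q : B) : c *: (p * q) = c *: p * q.
Proof. exact: mulrA. Qed.

HB.instance Definition _ := GRing.Lmodule_isLalgebra.Build k B B_scaleAl.
HB.instance Definition _ := GRing.Lalgebra_isComAlgebra.Build k B.

End Danielewski.

(* Main.v *)
(* (i) B_s carries the additive group action V |-> V + T^s W fixing k[T].      *)
(* Transport it along an isomorphism B_s -> B_r and pass to leading forms for  *)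
(* the order in which V dominates all the T_i. The graded algebra of B_r is    *)
(* the monoid algebra generated by T_i, V and U = V^d T^(-r), and the leading  *)
(* part of the action is homogeneous for the full grading by Z^(m+1), so it is *)
(* governed by the degree N(x) in the parameter, additive in the monomial x.   *)
(* If N(T_i) > 0 then N(T_i) = d n, N(V) = r_i n with d and r_i coprime and    *)
(* N vanishes on U and on the other variables; but some binomial coefficient   *)
(* C(N, h) with 0 < h <= n is nonzero in k, which yields an element of degree  *)
(* h, although every degree is a combination of d n and r_i n: a contradiction *)
(* as d, r_i > 1. Hence every invariant of the action is in k[T], so the       *)
(* isomorphism maps k[T] into k[T], and onto it because m + 1 polynomials in   *)
(* m variables are algebraically dependent. Comparing elements of V-degree 1   *)
(* and d then shows that T^s and T^r correspond up to a unit, so that the      *)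
(* isomorphism permutes the T_i up to scalars and s is a permutation of r.     *)
(* (ii) Let r <= s <= 2r and u F + v F' = 1. Then V' = V + T^r Z with          *)
(* Z = T^(s-r) Y - v(V) U identifies B_s[Z] with B_r[Y] (the coordinate ring   *)
(* of the fibre product of Danielewski), and any r is linked to (1, ..., 1) by *)
(* repeated halving.                                                           *)
Require Import Defs.
From mathcomp Require Import all_boot all_algebra.
From HB Require Import structures.
From mathcomp Require Import all_order.
From mathcomp Require Import perm fraction.
From mathcomp Require Import ring zify.

Set Implicit Arguments.
Unset Strict Implicit.
Unset Printing Implicit Defensive.

Import GRing.Theory Num.Theory Order.TTheory.
Local Open Scope ring_scope.

(** * Leading forms of higher derivations *)

(** Part (i) is a rigidity statement. It holds in every characteristic because derivations are
    replaced by locally finite iterative higher derivations: the coefficients of the action V |-> V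
    + T^s W on B_s ([exponential_exists]), which leave k[T] fixed. Carried to B_r by an isomorphism,
    they are studied on leading forms for a degree whose graded pieces are at most one-dimensional
    ([pres_degree_function]). There the action is recorded by one integer, the degree in the
    parameter, which depends only on the degree of an element and is additive ([ftop_deg],
    [ftop_mul]). When all r_i > 1, [ftop_x_eq0] shows that this integer vanishes on every T_i, so
    that invariants lie in k[T] ([fixed_in_coefs]) and the isomorphism maps k[T] into k[T]. It maps
    k[T] onto k[T] because elements of positive degree in V are transcendental over k[T], whereas
    the elements in question are algebraic ([algebraic_dependence], [coefs_onto_coefs]). Then V goes
    to an affine expression in V with unit slope ([gV_affine]), the leading coefficients of the
    images of U make T^s and T^r divide each other up to the induced automorphism of k[T]
    ([theta_tau_dvd]), and such an automorphism permutes the variables up to scalars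
    ([monomial_perm]). So r and s are permutations of each other, against (a) and (b) alike. For
    (ii), F(V) = T^r U vanishes modulo any divisor g of T^r, so u F + v F' = 1 makes v(V) an inverse
    of F'(V) modulo g. With g = T^(s-r) this solves for the substitutions of [forward_map] and
    [backward_map]; [stable_half] and [stable_ones] chain the resulting isomorphisms. *)

(* [{poly rat}] ordered by the sign of the leading coefficient serves as a     *)
(* divisible lexicographically ordered group.                                  *)
Section ExponentGroup.
Implicit Types x y z : {poly rat}.

Definition gle x y := 0 <= lead_coef (y - x).
Definition glt x y := 0 < lead_coef (y - x).

(** The leading coefficient of a sum is that of the longer summand, or, for equal sizes, a
    nonnegative plus a positive number. Transitivity and compatibility with addition of the order
    rest on this. *)
Lemma lead_coef_addr_gt0 x y :
  0 <= lead_coef x -> 0 < lead_coef y -> 0 < lead_coef (x + y).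
Proof.
move=> x0 y0; case: (ltngtP (size x) (size y)) => sxy.
- by rewrite lead_coefDr.
- rewrite lead_coefDl // lt_neqAle x0 andbT eq_sym lead_coef_eq0.
  by rewrite -size_poly_gt0 (leq_ltn_trans _ sxy).
have c0 : 0 < x`_(size y).-1 + y`_(size y).-1.
  by rewrite -{1}sxy -!lead_coefE ltr_wpDl.
suff sz : size (x + y) = size y by rewrite lead_coefE sz coefD.
apply/eqP; rewrite eqn_leq (leq_trans (size_polyD _ _)) ?sxy ?maxnn //=.
have : (x + y)`_(size y).-1 != 0 by rewrite coefD gt_eqF.
apply: contraR; rewrite -ltnNge => lt_s; rewrite nth_default //.
by rewrite -ltnS prednK // (leq_ltn_trans _ lt_s).
Qed.

Lemma glt_irr x : glt x x = false.
Proof. by rewrite /glt subrr lead_coef0 ltxx. Qed.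

Lemma gle_refl x : gle x x.
Proof. by rewrite /gle subrr lead_coef0. Qed.

Lemma gltW x y : glt x y -> gle x y.
Proof. exact: ltW. Qed.

Lemma gle_eqVlt x y : gle x y -> x = y \/ glt x y.
Proof.
rewrite /gle le_eqVlt eq_sym lead_coef_eq0 subr_eq0 => /orP[/eqP ->|]; by [left|right].
Qed.

Lemma glt_le_trans y x z : glt x y -> gle y z -> glt x z.
Proof.
move=> xy yz; rewrite /glt (_ : z - x = (z - y) + (y - x)); last by ring.
exact: lead_coef_addr_gt0.
Qed.

Lemma gle_lt_trans y x z : gle x y -> glt y z -> glt x z.
Proof.
move=> xy yz; rewrite /glt (_ : z - x = (y - x) + (z - y)); last by ring.
exact: lead_coef_addr_gt0.
Qed.

Lemma gle_trans y x z : gle x y -> gle y z -> gle x z.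
Proof. by move=> /gle_eqVlt[-> //|xy yz]; apply/gltW/(glt_le_trans xy). Qed.

Lemma gle_total x y : gle x y \/ glt y x.
Proof.
rewrite /gle /glt -opprB lead_coefN oppr_ge0.
by case: leP => ?; [left|right].
Qed.

Lemma gltNge x y : glt x y -> gle y x -> False.
Proof. by move=> xy /(glt_le_trans xy); rewrite glt_irr. Qed.

Lemma glt_leD x y z t : glt x y -> gle z t -> glt (x + z) (y + t).
Proof.
move=> xy zt; rewrite /glt (_ : _ - _ = (t - z) + (y - x)); last by ring.
exact: lead_coef_addr_gt0.
Qed.

Lemma gleD x y z t : gle x y -> gle z t -> gle (x + z) (y + t).
Proof.
move=> /gle_eqVlt[-> |xy zt]; last exact/gltW/glt_leD.
by rewrite /gle opprD addrACA subrr add0r.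
Qed.

Lemma gleDr z x y : gle (x + z) (y + z) = gle x y.
Proof. by rewrite /gle opprD addrACA subrr addr0. Qed.

Lemma gleZ c x y : 0 < c -> gle (c *: x) (c *: y) = gle x y.
Proof. by move=> c0; rewrite /gle -scalerBr lead_coefZ pmulr_rge0. Qed.

Lemma gle_min_seq (T : eqType) (f : T -> {poly rat}) (s : seq T) :
  s != [::] -> exists2 y : T, y \in s & forall z : T, z \in s -> gle (f y) (f z).
Proof.
elim: s => // x s; have [-> _ _|_ /(_ isT)[y ys ymin] _] := eqVneq s [::].
  exists x => [|z]; rewrite inE // => /eqP->; exact: gle_refl.
have [xy|/gltW yx] := gle_total (f x) (f y).
  exists x => [|z]; rewrite inE ?eqxx // => /predU1P[-> |/ymin]; first exact: gle_refl.
  exact: gle_trans.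
by exists y => [|z]; rewrite inE ?ys ?orbT // => /predU1P[->|/ymin].
Qed.

End ExponentGroup.

Section HigherDerivations.
Variables (k : fieldType) (A : comAlgType k).

(* The components of an action of the additive group on Spec A.              *)
Record higher_derivation (D : nat -> A -> A) : Prop := HigherDerivation {
  hd_add : forall n x y, D n (x + y) = D n x + D n y;
  hd_scale : forall n c x, D n (c *: x) = c *: D n x;
  hd_mul : forall n x y, D n (x * y) = \sum_(i < n.+1) D i x * D (n - i)%N y;
  hd_id : forall x, D 0 x = x;
  hd_one : forall n, (0 < n)%N -> D n 1 = 0;
  hd_comp : forall i j x, D i (D j x) = D (i + j)%N x *+ 'C(i + j, j);
  hd_fin : forall x, exists n, forall j, (n <= j)%N -> D j x = 0 }.

Variable deg : A -> {poly rat}.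

(* The value of [deg] at [0] is irrelevant: it plays the role of -oo.        *)
Definition dle g (x : A) := x = 0 \/ gle (deg x) g.
Definition dlt g (x : A) := x = 0 \/ glt (deg x) g.

(** [deg_mul] makes the associated graded algebra a domain; [deg_leaf] makes each of its pieces at
    most one-dimensional over k, so that a leading form is determined by its degree up to a
    scalar. *)
Record degree_function : Prop := DegreeFunction {
  deg_mul : forall x y : A, x != 0 -> y != 0 -> x * y != 0 /\ deg (x * y) = deg x + deg y;
  deg_add : forall g x y, dle g x -> dle g y -> dle g (x + y);
  deg_const : forall c : k, c != 0 -> deg (c%:A) = 0;
  deg_leaf : forall x y, x != 0 -> y != 0 -> deg x = deg y ->
    exists c : k, dlt (deg x) (x - c *: y) }.

Hypothesis degP : degree_function.
Implicit Types (x y b : A) (g h : {poly rat}).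

Lemma dltW g x : dlt g x -> dle g x.
Proof. by case=> [->|/gltW]; [left|right]. Qed.

Lemma dle_trans g h x : gle g h -> dle g x -> dle h x.
Proof. by move=> gh [->|xg]; [left|right; apply: gle_trans gh]. Qed.

Lemma dle_lt_trans g h x : glt g h -> dle g x -> dlt h x.
Proof. by move=> gh [->|xg]; [left|right; apply: gle_lt_trans gh]. Qed.

Lemma dle_deg x : dle (deg x) x.
Proof. by right; apply: gle_refl. Qed.

Lemma dlt_add g x y : dlt g x -> dlt g y -> dlt g (x + y).
Proof.
case=> [->|xg]; first by rewrite add0r.
case=> [->|yg]; first by rewrite addr0; right.
have [xy|/gltW yx] := gle_total (deg x) (deg y).
  apply: dle_lt_trans yg _; apply: (deg_add degP); by right => //; exact: gle_refl.
apply: dle_lt_trans xg _; apply: (deg_add degP); by right => //; exact: gle_refl.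
Qed.

Lemma dlt_sum (I : Type) (s : seq I) (P : pred I) (F : I -> A) g :
  (forall i, P i -> dlt g (F i)) -> dlt g (\sum_(i <- s | P i) F i).
Proof.
move=> h; apply: (big_ind (dlt g)) => //; [by left | exact: dlt_add].
Qed.

Lemma dle_sum (I : Type) (s : seq I) (P : pred I) (F : I -> A) g :
  (forall i, P i -> dle g (F i)) -> dle g (\sum_(i <- s | P i) F i).
Proof.
move=> h; apply: (big_ind (dle g)) => //; [by left | exact: (deg_add degP)].
Qed.

Lemma deg_mul_neq0 x y : x != 0 -> y != 0 -> x * y != 0.
Proof. by move=> x0 y0; case: (deg_mul degP x0 y0). Qed.

Lemma degM x y : x != 0 -> y != 0 -> deg (x * y) = deg x + deg y.
Proof. by move=> x0 y0; case: (deg_mul degP x0 y0). Qed.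

Lemma dle_mul g h x y : dle g x -> dle h y -> dle (g + h) (x * y).
Proof.
have [-> *|x0] := eqVneq x 0; first by left; rewrite mul0r.
have [-> *|y0] := eqVneq y 0; first by left; rewrite mulr0.
case=> [/eqP|xg]; first by rewrite (negPf x0).
case=> [/eqP|yh]; first by rewrite (negPf y0).
by right; rewrite degM //; apply: gleD.
Qed.

Lemma dlt_mull g h x y : dlt g x -> dle h y -> dlt (g + h) (x * y).
Proof.
have [-> *|x0] := eqVneq x 0; first by left; rewrite mul0r.
have [-> *|y0] := eqVneq y 0; first by left; rewrite mulr0.
case=> [/eqP|xg]; first by rewrite (negPf x0).
case=> [/eqP|yh]; first by rewrite (negPf y0).
by right; rewrite degM //; apply: glt_leD.
Qed.

Lemma dlt_mulr g h x y : dle g x -> dlt h y -> dlt (g + h) (x * y).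
Proof. by move=> xg yh; rewrite mulrC addrC; apply: dlt_mull. Qed.

Lemma const_alg_neq0 (c : k) : c != 0 -> (c%:A : A) != 0.
Proof.
move=> c0; apply: contraNneq (oner_neq0 A) => e.
by rewrite -[1](scale1r 1) -(mulVf c0) -scalerA e scaler0.
Qed.

Lemma scale_neq0 (c : k) x : c != 0 -> x != 0 -> c *: x != 0.
Proof.
by move=> c0 x0; rewrite -mulr_algl deg_mul_neq0 // const_alg_neq0.
Qed.

Lemma degZ (c : k) x : c != 0 -> x != 0 -> deg (c *: x) = deg x.
Proof.
move=> c0 x0; rewrite -mulr_algl degM ?const_alg_neq0 //.
by rewrite (deg_const degP) // add0r.
Qed.

Lemma dltZ g (c : k) x : dlt g x -> dlt g (c *: x).
Proof.
have [-> _|c0] := eqVneq c 0; first by left; rewrite scale0r.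
have [-> _|x0] := eqVneq x 0; first by left; rewrite scaler0.
by case=> [/eqP|xg]; [rewrite (negPf x0) | right; rewrite degZ].
Qed.

Lemma dlt_neq g x : dlt g x -> x != 0 -> deg x <> g.
Proof. by case=> [->|xg] x0 e; [rewrite eqxx in x0 | rewrite e glt_irr in xg]. Qed.

Lemma deg_add_dlt x y : x != 0 -> dlt (deg x) y ->
  x + y != 0 /\ deg (x + y) = deg x.
Proof.
move=> x0 yx; have xy0 : x + y != 0.
  apply/negP => /eqP/addr0_eq e; apply: dlt_neq (yx) _ _.
    by rewrite -e oppr_eq0.
  by rewrite -e -scaleN1r degZ // oppr_eq0 oner_eq0.
split=> //.
have [/eqP|] := deg_add degP (dle_deg x) (dltW yx); first by rewrite (negPf xy0).
case/gle_eqVlt => // lt; case: (dlt_neq _ x0 (erefl (deg x))).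
rewrite -[X in dlt _ X](addrK y); apply: dlt_add; first by right.
by rewrite -scaleN1r; apply: dltZ.
Qed.

Section LeadingForms.
Variables (D : nat -> A -> A) (w : {poly rat}).
Hypothesis Dhd : higher_derivation D.
Hypothesis Dw : forall b j, b != 0 -> dle (deg b - j%:R * w) (D j b).

(* [ftop b n]: the leading form of [b] has degree [n] in the parameter of the *)
(* action induced on the graded algebra, where the parameter has weight [w].  *)
Definition ftop b n := [/\ b != 0, D n b != 0, deg (D n b) = deg b - n%:R * w
  & forall j, (n < j)%N -> dlt (deg b - j%:R * w) (D j b)].

Lemma hd0 n : D n 0 = 0.
Proof. by have := hd_scale Dhd n 0 0; rewrite !scale0r. Qed.

Lemma ftop_exists b : b != 0 -> exists n, ftop b n.
Proof.
move=> b0; have [M hM] := hd_fin Dhd b.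
pose P j := (D j b != 0) && (deg (D j b) == deg b - j%:R * w).
have exP : exists j, P j.
  by exists 0%N; rewrite /P (hd_id Dhd) b0 mul0r subr0 eqxx.
have leP j : P j -> (j <= M)%N.
  by case/andP=> nz _; apply: contraNT nz; rewrite -ltnNge => /ltnW/hM->.
case: (ex_maxnP exP leP) => n /andP[n0 /eqP dn] nmax.
exists n; split=> // j; rewrite ltnNge => nj.
have [->|/gle_eqVlt[e|]] := Dw j b0; [by left | | by right].
have [z|nz] := eqVneq (D j b) 0; first by left.
by case/negP: nj; apply: nmax; rewrite /P nz e eqxx.
Qed.

Lemma ftop_unique b n n' : ftop b n -> ftop b n' -> n = n'.
Proof.
move=> [b0 n0 dn hn] [_ n0' dn' hn'].
case: (ltngtP n n') => [/hn lt|/hn' lt|//].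
  by case: (dlt_neq lt n0').
by case: (dlt_neq lt n0).
Qed.

(** The graded algebra is a domain, so leading coefficients in the parameter multiply: in the
    Leibniz sum of index n + m only the term D_n a D_m b reaches the bound. *)
Lemma ftop_mul a b n m : ftop a n -> ftop b m -> ftop (a * b) (n + m).
Proof.
move=> [a0 Dna0 dna hn] [b0 Dmb0 dmb hm].
have wt i j : (i <= j)%N -> deg (a * b) - j%:R * w =
    (deg a - i%:R * w) + (deg b - (j - i)%:R * w).
  by move=> ij; rewrite degM // natrB //; ring.
have small i j : (i <= j)%N -> (n < i)%N || (m < j - i)%N ->
    dlt (deg (a * b) - j%:R * w) (D i a * D (j - i)%N b).
  move=> ij /orP[ni|mi]; rewrite (wt i) //.
    by apply: dlt_mull; [apply: hn | apply: Dw].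
  by apply: dlt_mulr; [apply: Dw | apply: hm].
have [top0 dtop] : D (n + m)%N (a * b) != 0 /\
    deg (D (n + m)%N (a * b)) = deg (D n a * D m b).
  rewrite (hd_mul Dhd) (bigD1 (inord n)) //= inordK ?ltnS ?leq_addr // addKn.
  apply: deg_add_dlt; first exact: deg_mul_neq0.
  apply: dlt_sum => i; rewrite -val_eqE /= inordK ?ltnS ?leq_addr // => ni.
  rewrite degM // dna dmb -[X in _ + (_ - X%:R * _)](addKn n m) -wt ?leq_addr //.
  apply: small; first by rewrite -ltnS.
  by have := ltn_ord i; move: ni; lia.
split=> //; first exact: deg_mul_neq0.
  by rewrite dtop degM // dna dmb degM // natrD; ring.
move=> j nmj; rewrite (hd_mul Dhd); apply: dlt_sum => i _.
apply: small; first by rewrite -ltnS.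
by have := ltn_ord i; lia.
Qed.

Lemma dlt_hd g b j : dlt g b -> dlt (g - j%:R * w) (D j b).
Proof.
case=> [->|lt]; first by left; rewrite hd0.
have [->|b0] := eqVneq b 0; first by left; rewrite hd0.
apply: dle_lt_trans (Dw j b0).
by apply: glt_leD lt (gle_refl _).
Qed.

(** By [deg_leaf], b is a scalar multiple of a modulo lower degree, and lower terms stay below the
    bound under every D_j. Hence the degree in the parameter depends on the degree alone. *)
Lemma ftop_deg a b n : b != 0 -> deg a = deg b -> ftop a n -> ftop b n.
Proof.
move=> b0 dab [a0 Dna0 dna hn].
have [c] := deg_leaf degP b0 a0 (esym dab); set b' := b - _ => hb'.
have c0 : c != 0.
  apply: contraPneq hb' => c0.
  by rewrite /b' c0 scale0r subr0 => lt; apply: dlt_neq lt b0 _.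
have Db j : D j b = c *: D j a + D j b'.
  by rewrite -(hd_scale Dhd) -(hd_add Dhd) addrC subrK.
have [? e] : D n b != 0 /\ deg (D n b) = deg (c *: D n a).
  rewrite Db; apply: deg_add_dlt; first exact: scale_neq0.
  by rewrite degZ // dna dab; apply: dlt_hd.
split=> //; first by rewrite e degZ // dna dab.
move=> j nj; rewrite Db; apply: dlt_add; last exact: dlt_hd.
by rewrite -dab; apply/dltZ/hn.
Qed.

(** From D_h D_(n-h) = C(n, h) D_n: if the binomial survives in k, then D_(n-h) b reaches its bound
    and has degree exactly h in the parameter. *)
Lemma ftop_hd b n (h : nat) : ftop b n -> (h <= n)%N -> 'C(n, h)%:R != 0 :> k ->
  ftop (D (n - h)%N b) h /\ deg (D (n - h)%N b) = deg b - (n - h)%:R * w.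
Proof.
move=> [b0 Dnb0 dnb hn] hn' C0; set b1 := D _ b.
have Dh : D h b1 = 'C(n, h)%:R *: D n b.
  by rewrite (hd_comp Dhd) subnKC // bin_sub // scaler_nat.
have b10 : b1 != 0.
  apply: contra_neq (scale_neq0 C0 Dnb0) => e.
  by rewrite -Dh e hd0.
have db1 : deg b1 = deg b - (n - h)%:R * w.
  have [/eqP|] := Dw (n - h) b0; first by rewrite (negPf b10).
  case/gle_eqVlt => // lt.
  have lt1 : dlt (deg b - (n - h)%:R * w) b1 by right.
  have := dlt_hd h lt1; rewrite Dh natrB //.
  rewrite (_ : _ - _ - _ = deg b - n%:R * w); last by ring.
  by rewrite -dnb => /dlt_neq/(_ (scale_neq0 C0 Dnb0)); rewrite degZ.
split=> //; split=> //.
- by rewrite Dh scale_neq0.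
- by rewrite Dh degZ // dnb db1 natrB //; ring.
move=> j hj; rewrite (hd_comp Dhd) -[_ *+ 'C(_, _)]scaler_nat db1; apply: dltZ.
rewrite (_ : _ - _ = deg b - (j + (n - h))%:R * w); last by rewrite natrD; ring.
by apply: hn; lia.
Qed.

Lemma ftop_fixed b : b != 0 -> (forall j, (0 < j)%N -> D j b = 0) -> ftop b 0.
Proof.
move=> b0 fixb; split=> //; rewrite ?(hd_id Dhd) //; first by rewrite mul0r subr0.
by move=> j j0; left; apply: fixb.
Qed.

Lemma ftop_exp a n e : ftop a n -> ftop (a ^+ e) (n * e).
Proof.
move=> an; elim: e => [|e IHe]; last by rewrite exprS mulnS; apply: ftop_mul.
rewrite muln0; apply: ftop_fixed; first exact: oner_neq0.
exact: hd_one Dhd.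
Qed.

Lemma ftop_prod m (x : 'I_m -> A) (n e : 'I_m -> nat) :
  (forall i, ftop (x i) (n i)) ->
  ftop (\prod_i x i ^+ e i) (\sum_i n i * e i).
Proof.
move=> xn; apply: (big_ind2 (fun y l => ftop y l)) => //.
- apply: ftop_fixed; [exact: oner_neq0 | exact: hd_one Dhd].
- by move=> ? ? ? ?; apply: ftop_mul.
by move=> i _; apply: ftop_exp.
Qed.

End LeadingForms.

(** An induction principle standing for: every x is a sum of scalar multiples of products of
    generators, none of degree above that of x. *)
Definition generates_filtration (gens : seq A) :=
  forall Q : {poly rat} -> A -> Prop,
    (forall g, Q g 0) ->
    (forall g x y, Q g x -> Q g y -> Q g (x + y)) ->
    (forall g h x, gle g h -> Q g x -> Q h x) ->
    (forall g h x y, Q g x -> Q h y -> Q (g + h) (x * y)) ->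
    (forall c : k, Q 0 (c%:A)) ->
    (forall x, x \in gens -> Q (deg x) x) ->
    forall x, x != 0 -> Q (deg x) x.

(* The weight of the parameter is the least slope (deg g - deg D_j g) / j     *)
(* over the generators g.                                                     *)
Lemma weight_exists (D : nat -> A -> A) (gens : seq A) :
  higher_derivation D -> generates_filtration gens -> all (predC1 0) gens ->
  (exists2 x, x \in gens & exists2 j, (0 < j)%N & D j x != 0) ->
  exists w, (forall b j, b != 0 -> dle (deg b - j%:R * w) (D j b)) /\
    exists x n, x \in gens /\ (0 < n)%N /\ ftop D w x n.
Proof.
move=> Dhd gen /allP gens0 [x0 x0g [j0 j00 Dj0]].
pose slope (p : A * nat) := p.2%:R^-1 *: (deg p.1 - deg (D p.2 p.1)).
have [M hM] : exists M, forall x, x \in gens -> forall j, (M <= j)%N -> D j x = 0.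
  elim: (gens) => [|x s [M hM]]; first by exists 0%N.
  have [M' hM'] := hd_fin Dhd x; exists (maxn M M') => y.
  rewrite inE => /predU1P[->|ys] j; rewrite geq_max => /andP[Mj M'j].
    exact: hM'.
  exact: hM.
pose S := [seq p <- [seq (x, j) | x <- gens, j <- iota 1 M] | D p.2 p.1 != 0].
have inS x j : x \in gens -> (0 < j)%N -> D j x != 0 -> (x, j) \in S.
  move=> xg j1 nz; rewrite mem_filter nz /=; apply/allpairsP; exists (x, j).
  split=> //; rewrite mem_iota j1 add1n ltnS /=.
  by apply: contraNT nz; rewrite -ltnNge => /ltnW/hM ->.
have S0 : S != [::] by apply: contraTneq (inS _ _ x0g j00 Dj0) => ->.
have [[x n] xnS wmin] := gle_min_seq slope S0.
have [xg n0 Dnx] : [/\ x \in gens, (0 < n)%N & D n x != 0].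
  move: xnS; rewrite mem_filter => /andP[/= nz /allpairsP[[y j]]] [/= yg jM [ex en]]; subst y j.
  by move: jM; rewrite mem_iota => /andP[n1 _]; split.
have [w wE] : exists w, w = slope (x, n) by eexists.
exists w.
have natZ (j : nat) (p : {poly rat}) : j%:R * p = (j%:R : rat) *: p.
  by rewrite mulr_natl scaler_nat.
have Dw b j : b != 0 -> dle (deg b - j%:R * w) (D j b).
  move=> b0; move: j; apply: (gen (fun g x => forall j, dle (g - j%:R * w) (D j x))) => //.
  - by move=> g j; left; apply: (hd0 Dhd).
  - by move=> g y z hy hz j; rewrite (hd_add Dhd); apply: (deg_add degP); [apply: hy | apply: hz].
  - by move=> g h y gh hy j; apply: dle_trans (hy j); rewrite gleDr.
  - move=> g h y z hy hz j; rewrite (hd_mul Dhd); apply: dle_sum => i _.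
    have ij : (i <= j)%N by rewrite -ltnS.
    rewrite (_ : _ - _ = (g - i%:R * w) + (h - (j - i)%:R * w)).
      exact: dle_mul.
    by rewrite natrB //; ring.
  - move=> c [|j].
      rewrite mul0r subr0 (hd_id Dhd); have [->|c0] := eqVneq c 0.
        by left; rewrite scale0r.
      by rewrite -(deg_const degP c0); apply: dle_deg.
    by left; rewrite (hd_scale Dhd) (hd_one Dhd) // scaler0.
  move=> y yg [|j].
    by rewrite mul0r subr0 (hd_id Dhd); apply: dle_deg.
  have [->|nz] := eqVneq (D j.+1 y) 0; first by left.
  right; have := wmin _ (inS y j.+1 yg isT nz); rewrite -wE /slope /=.
  have j1 : 0 < j.+1%:R :> rat by rewrite ltr0n.
  rewrite -(gleZ _ _ j1) scalerA mulfV ?gt_eqF // scale1r -natZ.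
  by rewrite /gle; congr (0 <= lead_coef _); ring.
split=> //; have [l xl] := ftop_exists Dhd Dw (gens0 _ xg).
(* If l were 0, D_n x would lie strictly below the bound; but w is by choice the slope of the pair
   (x, n), which attains it. *)
exists x, l; split=> //; split=> //; rewrite lt0n; apply/eqP => l0.
case: xl => _ _ _ /(_ n); rewrite l0 => /(_ n0)/dlt_neq/(_ Dnx) []; rewrite natZ wE /slope /=.
by rewrite scalerA mulfV ?scale1r ?opprB 1?addrC ?subrK // pnatr_eq0 -lt0n.
Qed.

End HigherDerivations.

(* The coefficients of (1 + X)^n and (1 + X)^(n a) = ((1 + X)^n)^a at the     *)
(* first index h > 0 where the former does not vanish are c and a c.          *)
Lemma bin_mul_neq0 (k : fieldType) (n a : nat) : (0 < n)%N -> a%:R != 0 :> k ->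
  exists h, [/\ (0 < h)%N, (h <= n)%N & 'C(n * a, h)%:R != 0 :> k].
Proof.
move=> n0 a0; have exP : exists h, (0 < h)%N && ('C(n, h)%:R != 0 :> k).
  by exists n; rewrite n0 binn oner_neq0.
case: (ex_minnP exP) => h /andP[h0 Ch] hmin; exists h; split=> //.
  by apply: hmin; rewrite n0 binn oner_neq0.
have small j : (0 < j)%N -> (j < h)%N -> 'C(n, j)%:R = 0 :> k.
  move=> j0 jh; apply/eqP/negPn/negP => Cj; have := hmin j.
  by rewrite j0 Cj => /(_ isT); rewrite leqNgt jh.
suff -> : 'C(n * a, h)%:R = a%:R * 'C(n, h)%:R :> k by rewrite mulf_neq0.
elim: a {a0} => [|a IHa]; first by rewrite muln0 bin0n (gtn_eqF h0) mul0r.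
case: h h0 {Ch hmin} small IHa => // h _ small IHa.
rewrite mulnS -binomial.Vandermonde natr_sum big_ord_recl big_ord_recr /=.
rewrite big1 => [|i _]; last first.
  by rewrite natrM small ?mul0r //= /bump add1n ltnS ltn_ord.
rewrite /= bin0 mul1n subn0 IHa /bump add1n subnn bin0 muln1 add0r -[a.+1]addn1 natrD.
by rewrite mulrDl mul1r.
Qed.

(** * Rigidity when the leading form of the relation is x^r u = v^d *)

Section MonomialRigidity.
Variables (k : fieldType) (A : comAlgType k) (deg : A -> {poly rat}).
Hypothesis degP : degree_function deg.
Variables (m d : nat) (r : 'I_m -> nat) (x : 'I_m -> A) (v u : A).
Hypotheses (d_gt1 : (1 < d)%N) (r_gt1 : forall i, (1 < r i)%N).
Hypotheses (x_neq0 : forall i, x i != 0) (v_neq0 : v != 0) (u_neq0 : u != 0).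
Hypothesis deg_rel : \sum_i (r i)%:R *: deg (x i) + deg u = d%:R *: deg v.
Hypothesis deg_span : forall b : A, b != 0 -> exists (e : 'I_m -> nat) (j l : nat),
  deg b = \sum_i (e i)%:R *: deg (x i) + j%:R *: deg u + l%:R *: deg v.
Hypothesis deg_free : forall (c : 'I_m -> rat) (c' : rat),
  \sum_i c i *: deg (x i) + c' *: deg v = 0 -> (forall i, c i = 0) /\ c' = 0.
Hypothesis deg_gen : generates_filtration deg (v :: u :: [seq x i | i <- enum 'I_m]).
Variable D : nat -> A -> A.
Hypothesis Dhd : higher_derivation D.

Section Weight.
Variables (w : {poly rat}) (nx : 'I_m -> nat) (nv nu : nat).
Hypothesis Dw : forall b j, b != 0 -> dle deg (deg b - j%:R * w) (D j b).
Hypothesis x_top : forall i, ftop deg D w (x i) (nx i).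
Hypotheses (v_top : ftop deg D w v nv) (u_top : ftop deg D w u nu).

Lemma deg_exp (b : A) e : b != 0 -> b ^+ e != 0 /\ deg (b ^+ e) = e%:R *: deg b.
Proof.
move=> b0; elim: e => [|e [be0 IHe]].
  rewrite expr0 scale0r oner_neq0; split=> //.
  by have := deg_const degP (oner_neq0 k); rewrite scale1r.
rewrite exprS; have [-> ->] := deg_mul degP b0 be0; split=> //.
by rewrite IHe -{1}[deg b](scale1r) -scalerDl -natr1 addrC.
Qed.

Lemma deg_prod (e : 'I_m -> nat) :
  \prod_i x i ^+ e i != 0 /\ deg (\prod_i x i ^+ e i) = \sum_i (e i)%:R *: deg (x i).
Proof.
apply: (big_ind2 (fun y g => y != 0 /\ deg y = g)).
- by have [] := deg_exp 0 v_neq0; rewrite expr0 scale0r.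
- move=> y1 g1 y2 g2 [y10 <-] [y20 <-]; exact: deg_mul.
by move=> i _; apply: deg_exp.
Qed.

Lemma ftop_monomial b (e : 'I_m -> nat) (j l : nat) : b != 0 ->
  deg b = \sum_i (e i)%:R *: deg (x i) + j%:R *: deg u + l%:R *: deg v ->
  ftop deg D w b (\sum_i nx i * e i + nu * j + nv * l).
Proof.
move=> b0 db; have [p0 dp] := deg_prod e.
have [u0 du] := deg_exp j u_neq0; have [v0 dv] := deg_exp l v_neq0.
have [pu0 dpu] := deg_mul degP p0 u0; have [puv0 dpuv] := deg_mul degP pu0 v0.
apply: (ftop_deg degP Dhd Dw b0 (a := \prod_i x i ^+ e i * u ^+ j * v ^+ l)).
  by rewrite dpuv dpu dp du dv db.
do 2?apply: (ftop_mul degP Dhd Dw); last by apply: (ftop_exp degP Dhd Dw).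
  by apply: (ftop_prod degP Dhd Dw).
by apply: (ftop_exp degP Dhd Dw).
Qed.

Lemma ftop_rel : (\sum_i nx i * r i + nu = nv * d)%N.
Proof.
have [vd0 dvd] := deg_exp d v_neq0.
have := ftop_monomial (e := r) (j := 1) (l := 0) vd0.
rewrite dvd scale1r scale0r addr0 deg_rel => /(_ erefl) h.
have := ftop_unique h (ftop_exp degP Dhd Dw d v_top).
by rewrite muln1 muln0 addn0.
Qed.

(** D_n b has degree 0 in the parameter ([ftop_hd] with h = 0), so the monomial giving its degree
    involves only generators of parameter degree 0. *)
Lemma ftop_last b n : ftop deg D w b n -> exists (e : 'I_m -> nat) (j l : nat),
  (\sum_i nx i * e i + nu * j + nv * l = 0)%N /\
  deg b - n%:R *: w = \sum_i (e i)%:R *: deg (x i) + j%:R *: deg u + l%:R *: deg v.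
Proof.
move=> bn; have C0 : 'C(n, 0)%:R != 0 :> k by rewrite bin0 oner_neq0.
have [top0 dn] := ftop_hd degP Dhd Dw bn (leq0n _) C0.
rewrite subn0 in top0 dn; have b0 : D n b != 0 by case: top0.
have [e [j [l db]]] := deg_span b0; exists e, j, l; split.
  exact: ftop_unique (ftop_monomial b0 db) top0.
by rewrite -db dn mulr_natl scaler_nat.
Qed.

Lemma ftop_x_eq0 i : nx i = 0%N.
Proof.
apply/eqP/negPn/negP; rewrite -lt0n => nxi.
have nv0 : (0 < nv)%N.
  have : (0 < nv * d)%N.
    rewrite -ftop_rel (bigD1 i) //= -addnA addn_gt0 muln_gt0 nxi.
    by rewrite (ltnW (r_gt1 i)).
  by rewrite muln_gt0 => /andP[].
(* The two monomials obtained avoid v and every x_h with nx h > 0; in particular both avoid x_i. *)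
have [e [j [l [z1 dx]]]] := ftop_last (x_top i).
have [e' [j' [l' [z2 dv]]]] := ftop_last v_top.
have l0 : l = 0%N by move: z1 nv0; lia.
have l'0 : l' = 0%N by move: z2 nv0; lia.
have ez h : (0 < nx h)%N -> e h = 0%N.
  by move=> nh; move: z1 nh; rewrite (bigD1 h) //=; lia.
have e'z h : (0 < nx h)%N -> e' h = 0%N.
  by move=> nh; move: z2 nh; rewrite (bigD1 h) //=; lia.
(* Eliminating w between the two degree equations, and deg u by [deg_rel], leaves a linear relation
   among the independent degrees of the x_h and v. Its coefficients are c h and kap d - nx i. *)
pose kap : rat := (nx i * j')%:R - (nv * j)%:R.
pose c h : rat := (nx i * e' h)%:R - (nv * e h)%:R - kap * (r h)%:R + nv%:R * (h == i)%:R.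
have [cz] : (forall h, c h = 0) /\ (kap * d%:R - (nx i)%:R = 0).
  apply: deg_free.
  have -> : \sum_h c h *: deg (x h) = (nx i)%:R *: (\sum_h (e' h)%:R *: deg (x h))
      - nv%:R *: (\sum_h (e h)%:R *: deg (x h))
      - kap *: (\sum_h (r h)%:R *: deg (x h)) + nv%:R *: deg (x i).
    rewrite !scaler_sumr -!sumrB.
    have -> : nv%:R *: deg (x i) = \sum_h (nv%:R * (h == i)%:R) *: deg (x h).
      rewrite (bigD1 i) //= eqxx mulr1 big1 ?addr0 // => h /negPf->.
      by rewrite mulr0 scale0r.
    rewrite -big_split /=; apply: eq_bigr => h _.
    by rewrite !scalerA -!scalerBl -scalerDl /c !natrM.
  have -> : \sum_h (r h)%:R *: deg (x h) = d%:R *: deg v - deg u.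
    by rewrite -deg_rel addrK.
  move: dx dv; rewrite l0 l'0 scale0r !addr0 => dx dv.
  have -> : \sum_h (e h)%:R *: deg (x h) = deg (x i) - (nx i)%:R *: w - j%:R *: deg u.
    by rewrite dx addrK.
  have -> : \sum_h (e' h)%:R *: deg (x h) = deg v - nv%:R *: w - j'%:R *: deg u.
    by rewrite dv addrK.
  rewrite !scalerBr scalerBl !scalerA /kap !scalerBl !mulrBl !natrM !scalerBl.
  have sw a b : a%:R * b%:R = b%:R * a%:R :> rat by rewrite mulrC.
  rewrite (sw nv (nx i)).
  by ring.
move/eqP; rewrite subr_eq0 => /eqP kd.
have kr : kap * (r i)%:R = nv%:R.
  have := cz i; rewrite /c ez // e'z // !muln0 eqxx mulr1 subrr sub0r.
  by move/eqP; rewrite addrC subr_eq0 => /eqP ->.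
have kap_gt0 : 0 < kap.
  by have : 0 < kap * d%:R; [rewrite kd ltr0n | rewrite pmulr_lgt0 // ltr0n ltnW].
have others h : h != i -> nx h = 0%N.
  move=> hi; apply/eqP/negPn/negP; rewrite -lt0n => nh; have := cz h.
  rewrite /c ez // e'z // !muln0 (negPf hi) mulr0 addr0 subrr sub0r => /eqP.
  by rewrite oppr_eq0 mulf_eq0 gt_eqF //= pnatr_eq0 -leqn0 leqNgt (ltnW (r_gt1 h)).
pose n := (nx i * j' - nv * j)%N.
have kn : kap = n%:R.
  rewrite /n natrB // -(ler_nat rat) -subr_ge0; exact: ltW.
have nxE : nx i = (n * d)%N.
  by apply/eqP; rewrite -(eqr_nat rat) -kd kn natrM.
have nvE : nv = (n * r i)%N.
  by apply/eqP; rewrite -(eqr_nat rat) -kr kn natrM.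
have n_gt0 : (0 < n)%N by rewrite -(ltr_nat rat) -kn.
(* Substitute nx i = n d and nv = n r_i in n = nx i j' - nv j, then cancel n. *)
have bezout : (d * j' = r i * j + 1)%N.
  apply/eqP; rewrite -(eqn_pmul2l n_gt0) mulnDr muln1 !mulnA -nxE -nvE.
  by apply/eqP; move: n_gt0; rewrite /n; lia.
have nu0 : nu = 0%N.
  have := ftop_rel; rewrite (bigD1 i) //= big1 => [|h /others->]; last by rewrite mul0n.
  by rewrite nxE nvE; nia.
have tops b h : ftop deg D w b h -> exists e1 e2, h = (n * (d * e1 + r i * e2))%N.
  move=> bh; have b0 : b != 0 by case: bh.
  have [f [j1 [l1 db]]] := deg_span b0; exists (f i), l1.
  rewrite (ftop_unique bh (ftop_monomial b0 db)) (bigD1 i) //= big1 => [|t /others->].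
    by rewrite nu0 nxE nvE; ring.
  by rewrite mul0n.
(* By [bezout], d and r_i cannot both vanish in k; a is one that does not, and y is x_i or v
   accordingly. *)
have [a [y [a0 ya]]] : exists a y, a%:R != 0 :> k /\ ftop deg D w y (n * a).
  have [d0|d0] := eqVneq (d%:R : k) 0; last by exists d, (x i); rewrite -nxE.
  exists (r i), v; rewrite -nvE; split=> //; apply: contraTneq isT => r0.
  have := congr1 (fun t => t%:R : k) bezout.
  by rewrite natrM natrD natrM d0 r0 !mul0r add0r => /esym/eqP; rewrite oner_eq0.
have [h [h0 hn Ch]] := bin_mul_neq0 n_gt0 a0.
have hna : (h <= n * a)%N.
  by rewrite leqNgt; apply: contraNN Ch => /bin_small ->.
(* Here 0 < h <= n and h = n (d e1 + r_i e2), forcing d e1 + r_i e2 = 1, which is impossible for d,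
   r_i > 1. *)
have [/tops[e1 [e2 he]] _] := ftop_hd degP Dhd Dw ya hna Ch.
have := r_gt1 i; move: h0 hn; rewrite he muln_gt0 => /andP[_].
case: e1 {he} => [|e1]; last by nia.
by case: e2 => [|e2]; nia.
Qed.
End Weight.

(** As the x_i have parameter degree 0, u has d times that of v, and some generator has a positive
    one, v and u both have positive parameter degree. A fixed element has parameter degree 0, so
    neither occurs in its degree. *)
Lemma fixed_degree (b : A) :
  (exists y j, (0 < j)%N /\ y \in v :: u :: [seq x i | i <- enum 'I_m] /\ D j y != 0) ->
  b != 0 -> (forall j, (0 < j)%N -> D j b = 0) ->
  exists e : 'I_m -> nat, deg b = \sum_i (e i)%:R *: deg (x i).
Proof.
move=> [y0 [j0 [j00 [y0g Dy0]]]] b0 bfix.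
have gens0 : all (predC1 0) (v :: u :: [seq x i | i <- enum 'I_m]).
  by rewrite /= v_neq0 u_neq0; apply/allP => z /mapP[i _ ->]; apply: x_neq0.
have [|w [Dw [y [n [yg [n0 yn]]]]]] := weight_exists degP Dhd deg_gen gens0.
  by exists y0 => //; exists j0.
have [nx x_top] : exists nx : 'I_m -> nat, forall i, ftop deg D w (x i) (nx i).
  by apply: (fin_all_exists (fun i => ftop_exists Dhd Dw (x_neq0 i))).
have [nv v_top] := ftop_exists Dhd Dw v_neq0.
have [nu u_top] := ftop_exists Dhd Dw u_neq0.
have nx0 := ftop_x_eq0 Dw x_top v_top u_top.
have sum0 (e : 'I_m -> nat) : \sum_i nx i * e i = 0%N.
  by rewrite big1 // => i _; rewrite nx0.
have nuE : nu = (nv * d)%N.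
  by rewrite -(ftop_rel Dw x_top v_top u_top) sum0.
have nv0 : (0 < nv)%N.
  rewrite lt0n; apply: contraTneq n0 => nv0; rewrite -leqNgt leqn0.
  move: yg; rewrite !inE => /or3P[/eqP e|/eqP e|/mapP[i _ e]]; rewrite e in yn.
  - by rewrite (ftop_unique yn v_top) nv0.
  - by rewrite (ftop_unique yn u_top) nuE nv0.
  by rewrite (ftop_unique yn (x_top i)) nx0.
have [e [j [l db]]] := deg_span b0; exists e.
have := ftop_unique (ftop_fixed deg w Dhd b0 bfix) (ftop_monomial Dw x_top v_top u_top b0 db).
rewrite sum0 add0n nuE db => /esym/eqP.
rewrite addn_eq0 !muln_eq0 (gtn_eqF nv0) (gtn_eqF (ltnW d_gt1)) /=.
by move=> /andP[/eqP-> /eqP->]; rewrite !scale0r !addr0.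
Qed.

End MonomialRigidity.

(** * The algebras B and their normal form *)

Lemma mpoly_morph_ext (n : nat) (R S : comNzRingType) (f g : {rmorphism {mpoly R[n]} -> S}) :
  (forall c, f c%:MP = g c%:MP) -> (forall i, f 'X_i = g 'X_i) -> f =1 g.
Proof.
move=> fgC fgX p; rewrite [p]mpolyE !raddf_sum /=; apply: eq_bigr => m _.
rewrite -mul_mpolyC !rmorphM /= fgC; congr (_ * _).
rewrite mpolyXE_id !rmorph_prod; apply: eq_bigr => i _.
by rewrite !rmorphXn /= fgX.
Qed.

Lemma mmap_morph (n : nat) (R S : comNzRingType) (h : {rmorphism {mpoly R[n]} -> S}) p :
  mmap (h \o @mpolyC n R) (fun i => h 'X_i) p = h p.
Proof.
apply: (mpoly_morph_ext (f := mmap (h \o @mpolyC n R) (fun i => h 'X_i))) => [c|i] /=.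
  by rewrite mmapC.
by rewrite mmapX mmap1U.
Qed.

Section Extend.
Variables (S : comNzRingType) (n : nat).

Definition ext (t : 'I_n -> S) (x : S) (i : 'I_n.+1) : S :=
  if unlift ord_max i is Some j then t j else x.

Lemma ext_widen t x i : ext t x (widen_ord (leqnSn n) i) = t i.
Proof.
have -> : widen_ord (leqnSn n) i = lift ord_max i.
  by apply: val_inj; rewrite /= /bump leqNgt ltn_ord.
by rewrite /ext liftK.
Qed.

Lemma ext_max t x : ext t x ord_max = x.
Proof. by rewrite /ext unlift_none. Qed.

Lemma mmap_mwiden (R : comNzRingType) (f : {rmorphism R -> S}) t x p :
  mmap f (ext t x) (mwiden p) = mmap f t p.
Proof.
pose g : {rmorphism {mpoly R[n]} -> S} := mmap f (ext t x) \o @mwiden n R.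
apply: (mpoly_morph_ext (f := g)) => [c|i] /=.
  by rewrite mwidenC !mmapC.
by rewrite mwidenX mnmwiden1 !mmapX !mmap1U ext_widen.
Qed.
End Extend.

Section Presentation.
Variables (k : fieldType) (m d : nat) (a : 'I_d -> {mpoly k[m]}) (r : m.-tuple nat).
Local Notation R := {mpoly k[m]}.

(* The universal property of [B a r], with [c] the inclusion of k[T].         *)
Record presentation (A : comAlgType k) (c : {rmorphism R -> A}) (V U : A) : Prop :=
  Presentation {
  pres_const : forall x, c x%:MP = x%:A;
  pres_rel : c (monoT k r) * U = \sum_(i < d) c (a i) * V ^+ i + V ^+ d;
  pres_ind : forall P : A -> Prop, (forall p, P (c p)) -> P V -> P U ->
    (forall x y, P x -> P y -> P (x + y)) -> (forall x y, P x -> P y -> P (x * y)) ->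
    forall x, P x;
  pres_lift : forall (S : comNzRingType) (f : {rmorphism R -> S}) (x u : S),
    f (monoT k r) * u = \sum_(i < d) f (a i) * x ^+ i + x ^+ d ->
    exists g : {rmorphism A -> S}, [/\ forall p, g (c p) = f p, g V = x & g U = u] }.
End Presentation.

Section Coordinates.
Variables (k : fieldType) (m d : nat) (a : 'I_d -> {mpoly k[m]}) (r : m.-tuple nat).
Local Notation B := (B a r).

Definition Bc (p : {mpoly k[m]}) : B := projB a r (mwiden (mwiden p)).
Definition BV : B := projB a r (mwiden 'X_ord_max).
Definition BU : B := projB a r 'X_ord_max.

Lemma projBD p q : projB a r (p + q) = projB a r p + projB a r q.
Proof. exact: (rmorphD \pi_({ideal_quot (idealB a r)})%qT). Qed.

Lemma projB0 : projB a r 0 = 0.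
Proof. exact: (rmorph0 \pi_({ideal_quot (idealB a r)})%qT). Qed.

Lemma projB_exp p n : projB a r (p ^+ n) = projB a r p ^+ n.
Proof. exact: (rmorphXn \pi_({ideal_quot (idealB a r)})%qT). Qed.

Fact Bc_is_zmod_morphism : zmod_morphism Bc.
Proof.
move=> p q; rewrite /Bc !mwidenB.
exact: (rmorphB \pi_({ideal_quot (idealB a r)})%qT).
Qed.
HB.instance Definition _ := GRing.isZmodMorphism.Build _ _ Bc Bc_is_zmod_morphism.

Fact Bc_is_monoid_morphism : monoid_morphism Bc.
Proof.
split=> [|p q]; rewrite /Bc; last by rewrite !mwidenM projBM.
by rewrite !mwiden1; exact: (rmorph1 \pi_({ideal_quot (idealB a r)})%qT).
Qed.
HB.instance Definition _ := GRing.isMonoidMorphism.Build _ _ Bc Bc_is_monoid_morphism.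

Lemma Bc_const c : Bc c%:MP = c%:A.
Proof. by rewrite /Bc !mwidenC /GRing.scale /= /B_scale mulr1. Qed.

Lemma B_lift (S : comNzRingType) (f : {rmorphism {mpoly k[m]} -> S}) (x u : S) :
  f (monoT k r) * u = \sum_(i < d) f (a i) * x ^+ i + x ^+ d ->
  exists g : {rmorphism B -> S}, [/\ forall p, g (Bc p) = f p, g BV = x & g BU = u].
Proof.
move=> rel; pose f0 := f \o @mpolyC m k; pose t i := f 'X_i.
have fE p : mmap f0 t p = f p by apply: mmap_morph.
pose h : {rmorphism {mpoly k[m.+2]} -> S} := mmap f0 (ext (ext t x) u).
have hw p : h (mwiden p) = mmap f0 (ext t x) p by apply: mmap_mwiden.
have hF : mmap f0 (ext t x) (polyF a) = \sum_(i < d) f (a i) * x ^+ i + x ^+ d.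
  rewrite /polyF rmorphD rmorph_sum rmorphXn /= mmapX mmap1U ext_max; congr (_ + _).
  apply: eq_bigr => i _; rewrite (rmorphM (mmap f0 (ext t x))) rmorphXn /=.
  by rewrite mmap_mwiden fE mmapX mmap1U ext_max.
have hrel : h (relB a r) = 0.
  rewrite /relB rmorphB rmorphM /= !hw mmap_mwiden fE hF.
  by rewrite /h /= mmapX mmap1U ext_max rel subrr.
(* Since h kills [relB], its value does not depend on the representative. *)
pose g (y : B) := h (repr y).
have gE p : g (projB a r p) = h p.
  apply/eqP; rewrite /g -subr_eq0 -rmorphB.
  have : repr (projB a r p) == p %[mod {ideal_quot (idealB a r)}]%qT by rewrite reprK.
  by rewrite -Quotient.idealrBE => /boolp.asboolP[q ->]; rewrite rmorphM /= hrel mulr0.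
have projK (y : B) : y = projB a r (repr y) by rewrite /projB reprK.
have gB : zmod_morphism g.
  move=> y z; rewrite [y]projK [z]projK.
  rewrite -[_ - _](rmorphB \pi_({ideal_quot (idealB a r)})%qT) /= !gE.
  exact: rmorphB.
have gM : monoid_morphism g.
  split=> [|y z].
    have -> : (1 : B) = projB a r 1.
      by symmetry; exact: (rmorph1 \pi_({ideal_quot (idealB a r)})%qT).
    rewrite gE; exact: rmorph1.
  rewrite [y]projK [z]projK -projBM !gE; exact: rmorphM.
pose g' : {rmorphism B -> S} := HB.pack g (GRing.isZmodMorphism.Build _ _ g gB)
  (GRing.isMonoidMorphism.Build _ _ g gM).
exists g'; split=> /= [p||].
- by rewrite /Bc gE hw mmap_mwiden fE.
- by rewrite /BV gE hw mmapX mmap1U ext_max.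
- by rewrite /BU gE /h /= mmapX mmap1U ext_max.
Qed.

Lemma B_ind (P : B -> Prop) : (forall p, P (Bc p)) -> P BV -> P BU ->
  (forall x y, P x -> P y -> P (x + y)) -> (forall x y, P x -> P y -> P (x * y)) ->
  forall x, P x.
Proof.
move=> Pc PV PU PD PM y.
have -> : y = projB a r (repr y) by rewrite /projB reprK.
elim/mpolyind: (repr y) => [|c e p _ _ IHp].
  by have := Pc 0; rewrite /Bc !mwiden0.
rewrite projBD; apply: (PD) => //; rewrite -mul_mpolyC projBM; apply: (PM).
  by have := Pc c%:MP; rewrite /Bc !mwidenC.
rewrite mpolyXE_id; apply: (big_ind (fun q => P (projB a r q))).
- by have := Pc 1; rewrite /Bc !mwiden1.
- by move=> p1 p2; rewrite projBM; apply: (PM).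
move=> i _; elim: (e i) => [|n IHn].
  by have := Pc 1; rewrite /Bc !mwiden1 expr0.
rewrite exprS projBM; apply: (PM) => //.
have [->|[j ->]] : i = ord_max \/ exists j, i = widen_ord (leqnSn _) j.
- case: (unliftP ord_max i) => [j ->|->]; [right|by left].
  by exists j; apply: val_inj; rewrite /= /bump leqNgt ltn_ord.
- exact: PU.
rewrite -mnmwiden1 -mwidenX.
have [->|[l ->]] : j = ord_max \/ exists l, j = widen_ord (leqnSn _) l.
- case: (unliftP ord_max j) => [l ->|->]; [right|by left].
  by exists l; apply: val_inj; rewrite /= /bump leqNgt ltn_ord.
- exact: PV.
by rewrite -mnmwiden1 -mwidenX; apply: (Pc).
Qed.

Lemma B_rel : Bc (monoT k r) * BU = \sum_(i < d) Bc (a i) * BV ^+ i + BV ^+ d.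
Proof.
have <- : projB a r (mwiden (polyF a)) = \sum_(i < d) Bc (a i) * BV ^+ i + BV ^+ d.
  rewrite /polyF mwidenD raddf_sum (rmorphXn (@mwiden m.+1 k)) /= projBD projB_exp; congr (_ + _).
  rewrite (big_morph _ projBD projB0); apply: eq_bigr => i _.
  by rewrite mwidenM (rmorphXn (@mwiden m.+1 k)) /= projBM projB_exp.
rewrite /Bc /BU -projBM; apply/eqP.
suff : mwiden (mwiden (monoT k r)) * 'X_ord_max == mwiden (polyF a)
    %[mod {ideal_quot (idealB a r)}]%qT by [].
by rewrite -Quotient.idealrBE; apply/boolp.asboolP; exists 1; rewrite mul1r.
Qed.

Lemma B_presentation : presentation a r Bc BV BU.
Proof.
split; [exact: Bc_const | exact: B_rel | exact: B_ind | exact: B_lift].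
Qed.
End Coordinates.

Section DefiningPolynomial.
Variables (k : fieldType) (m d : nat) (a : 'I_d -> {mpoly k[m]}).
Local Notation R := {mpoly k[m]}.

Definition Fpoly : {poly R} := \sum_(i < d) (a i)%:P * 'X^i + 'X^d.

Lemma size_lead_Fpoly : size Fpoly = d.+1 /\ lead_coef Fpoly = 1.
Proof.
have sz : (size (\sum_(i < d) (a i)%:P * 'X^i : {poly R})%R <= d)%N.
  apply: (leq_trans (size_sum _ _ _)); apply/bigmax_leqP => i _.
  apply: (leq_trans (size_polyMleq _ _)); rewrite size_polyXn addnS /=.
  by rewrite size_polyC; case: (_ != 0) => /=; have := ltn_ord i; lia.
by rewrite /Fpoly addrC size_polyDl ?lead_coefDl size_polyXn ?ltnS // lead_coefXn.
Qed.


Definition evalV (S : comNzRingType) (f : {rmorphism R -> S}) (x : S) (p : {poly R}) : S :=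
  (map_poly f p).[x].

Lemma evalV_Fpoly (S : comNzRingType) (f : {rmorphism R -> S}) x :
  evalV f x Fpoly = \sum_(i < d) f (a i) * x ^+ i + x ^+ d.
Proof.
rewrite /evalV /Fpoly rmorphD rmorph_sum /= map_polyXn hornerD hornerXn horner_sum.
congr (_ + _); apply: eq_bigr => i _.
by rewrite rmorphM /= map_polyC map_polyXn hornerM hornerC hornerXn.
Qed.

Lemma evalV_morph (S T : comNzRingType) (f : {rmorphism R -> S}) (f' : {rmorphism R -> T})
  (g : {rmorphism S -> T}) x p : (forall y, g (f y) = f' y) ->
  g (evalV f x p) = evalV f' (g x) p.
Proof.
move=> gf; rewrite /evalV -horner_map -map_poly_comp; congr (_.[_]).
by apply: eq_map_poly => y /=; rewrite gf.
Qed.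

(** The remainder is made of divided derivatives, so the expansion is valid in every
    characteristic. *)
Lemma evalV_taylor (S : comNzRingType) (f : {rmorphism R -> S}) x h p : exists H,
  evalV f (x + h) p = evalV f x p + evalV f x p^`() * h + h ^+ 2 * H.
Proof.
exists (\sum_(i < size (map_poly f p)) (map_poly f p)^`N(i.+2).[x] * h ^+ i).
rewrite /evalV (@nderiv_taylor_wide _ (size (map_poly f p)).+2) //; last first.
- exact: leqW.
- exact: mulrC.
rewrite !big_ord_recl /= !nderivn0 nderivn1 expr0 mulr1 expr1 deriv_map addrA.
congr (_ + _); rewrite mulr_sumr; apply: eq_bigr => i _.
by rewrite /bump /= !add1n !exprS; ring.
Qed.

End DefiningPolynomial.

(** * Embedding in K[X] and normal form over k[T] *)

Section LaurentEmbedding.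
Variables (k : fieldType) (m d : nat) (a : 'I_d -> {mpoly k[m]}) (r : m.-tuple nat).
Local Notation R := {mpoly k[m]}.
Hypothesis d_gt0 : (0 < d)%N.
Variables (A : comAlgType k) (c : {rmorphism {mpoly k[m]} -> A}) (V U : A).
Hypothesis presA : presentation a r c V U.
Variables (K : fieldType) (j : {rmorphism R -> K}).
Hypothesis j_eq0 : forall p, (j p == 0) = (p == 0).
Local Notation tau := (monoT k r).
Implicit Types (p : R) (q b : {poly R}).

Lemma monoT_neq0 : tau != 0.
Proof.
by apply/prodf_neq0 => i _; rewrite expf_neq0 // -msize_poly_eq0 msizeX.
Qed.

Lemma jtau_neq0 : j tau != 0.
Proof. by rewrite j_eq0 monoT_neq0. Qed.

Definition FK : {poly K} := map_poly j (Fpoly a).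

Lemma size_FK : size FK = d.+1 /\ lead_coef FK = 1.
Proof.
have [sF lF] := size_lead_Fpoly a; have l0 : j (lead_coef (Fpoly a)) != 0.
  by rewrite lF rmorph1 oner_neq0.
by rewrite /FK size_map_poly_id0 // lead_coef_map_id0 ?rmorph0 // lF rmorph1.
Qed.

(** Once T^r is inverted, the relation gives U as F / T^r. K is any field containing k[T]; the
    fraction field is supplied later. Injectivity is [iota_eq0]. *)
Lemma iota_exists : exists g : {rmorphism A -> {poly K}},
  [/\ forall p, g (c p) = (j p)%:P, g V = 'X & j tau *: g U = FK].
Proof.
have [|g [gc gV gU]] := pres_lift presA (f := polyC \o j) (x := 'X) (u := (j tau)^-1 *: FK).
  rewrite -evalV_Fpoly /= mul_polyC scalerA divff ?scale1r ?jtau_neq0 //.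
  by rewrite /evalV map_poly_comp; apply/esym/comp_polyXr.
by exists g; split=> //; rewrite gU scalerA divff ?scale1r // jtau_neq0.
Qed.

Definition iota : {rmorphism A -> {poly K}} := projT1 (boolp.cid iota_exists).

Lemma iota_c p : iota (c p) = (j p)%:P.
Proof. by rewrite /iota; case: boolp.cid => g [/= ->]. Qed.

Lemma iota_V : iota V = 'X.
Proof. by rewrite /iota; case: boolp.cid => g [/= _ ->]. Qed.

Lemma iota_U : j tau *: iota U = FK.
Proof. by rewrite /iota; case: boolp.cid => g [/= _ _ ->]. Qed.

(* [A] is free over k[T] on the [UV i], and [UV i] has degree i in V.          *)
Definition UV i : A := U ^+ (i %/ d) * V ^+ (i %% d).

Lemma iota_UV i : size (iota (UV i)) = i.+1 /\
  lead_coef (iota (UV i)) = (j tau)^- (i %/ d).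
Proof.
have [sF lF] := size_FK.
have uE : iota U = (j tau)^-1 *: FK.
  by rewrite -iota_U scalerA mulVf ?scale1r // jtau_neq0.
have t0 := jtau_neq0; have F0 : FK != 0 by rewrite -size_poly_gt0 sF.
have lE : lead_coef (iota (UV i)) = (j tau)^- (i %/ d).
  rewrite /UV rmorphM !rmorphXn /= iota_V lead_coefM lead_coefXn mulr1 uE.
  by rewrite lead_coef_exp lead_coefZ lF mulr1 exprVn.
split=> //.
rewrite /UV rmorphM !rmorphXn /= iota_V uE size_mulXn ?expf_neq0 //; last first.
  by rewrite scaler_eq0 invr_eq0 negb_or t0.
rewrite exprZn size_scale ?expf_neq0 ?invr_eq0 //.
have := size_exp FK (i %/ d); rewrite sF /=.
have : (0 < size (FK ^+ (i %/ d)))%N by rewrite size_poly_gt0 expf_neq0.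
case: (size _) => // s _ /= ->.
by rewrite mulnC addnS addnC -divn_eq.
Qed.

Definition NF (b : {poly R}) : A := \sum_(i < size b) c b`_i * UV i.

Lemma NF_wide (b : {poly R}) n : (size b <= n)%N -> NF b = \sum_(i < n) c b`_i * UV i.
Proof.
move=> bn; rewrite /NF (big_ord_widen _ (fun i => c b`_i * UV i) bn) big_mkcond /=.
apply: eq_bigr => i _; case: ltnP => // ib.
by rewrite nth_default // rmorph0 mul0r.
Qed.

(** The images of the [UV i] have pairwise distinct sizes, so the last term dominates. This shows at
    once that normal forms are unique and that [iota] loses nothing on them. *)
Lemma iota_NF b : size (iota (NF b)) = size b /\
  lead_coef (iota (NF b)) = j (lead_coef b) * (j tau)^- ((size b).-1 %/ d).
Proof.
have [->|b0] := eqVneq b 0.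
  by rewrite /NF size_poly0 big_ord0 rmorph0 size_poly0 !lead_coef0 rmorph0 mul0r.
have [n sb] : exists n, size b = n.+1.
  by exists (size b).-1; rewrite prednK // size_poly_gt0.
have [su lu] := iota_UV n.
have bn : j b`_n != 0.
  by rewrite j_eq0 -[n]/(n.+1.-1) -sb -lead_coefE lead_coef_eq0.
have top : size (iota (c b`_n * UV n)) = n.+1.
  by rewrite rmorphM /= iota_c mul_polyC size_scale.
have lo : (size (iota (\sum_(i < n) c b`_i * UV i)%R) <= n)%N.
  rewrite rmorph_sum; apply: (leq_trans (size_sum _ _ _)); apply/bigmax_leqP => i _.
  rewrite rmorphM /= iota_c mul_polyC; apply: (leq_trans (size_scale_leq _ _)).
  by have [->] := iota_UV i.
rewrite /NF sb big_ord_recr /= [_ + c _ * _]addrC rmorphD /=; split.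
  by rewrite size_polyDl top // ltnS.
rewrite lead_coefDl ?top // rmorphM /= iota_c mul_polyC lead_coefZ lu.
by rewrite lead_coefE sb.
Qed.

Definition isNF (x : A) := exists b, x = NF b.

Lemma isNF0 : isNF 0.
Proof. by exists 0; rewrite /NF size_poly0 big_ord0. Qed.

Lemma isNFD x y : isNF x -> isNF y -> isNF (x + y).
Proof.
move=> [b ->] [b' ->]; exists (b + b').
rewrite (NF_wide (leq_maxl (size b) (size b'))) (NF_wide (leq_maxr (size b) (size b'))).
rewrite (NF_wide (size_polyD b b')) -big_split; apply: eq_bigr => i _.
by rewrite coefD rmorphD mulrDl.
Qed.

Lemma isNF_sum (I : Type) (s : seq I) (P : pred I) (F : I -> A) :
  (forall i, P i -> isNF (F i)) -> isNF (\sum_(i <- s | P i) F i).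
Proof. by move=> h; apply: (big_ind isNF) => //; [exact: isNF0 | exact: isNFD]. Qed.

Lemma isNF_UV p i : isNF (c p * UV i).
Proof.
exists (p%:P * 'X^i); rewrite (@NF_wide _ i.+1); last first.
  apply: (leq_trans (size_polyMleq _ _)); rewrite size_polyXn addnS /=.
  by rewrite size_polyC; case: (_ != 0).
rewrite big_ord_recr /= coefCM coefXn eqxx mulr1 big1 ?add0r // => i' _.
by rewrite coefCM coefXn ltn_eqF // mulr0 rmorph0 mul0r.
Qed.

Lemma isNF_mulU x : isNF x -> isNF (U * x).
Proof.
move=> [b ->]; rewrite /NF mulr_sumr; apply: isNF_sum => i _.
have -> : U * (c b`_i * UV i) = c b`_i * UV (i + d).
  by rewrite /UV divnDr // divnn d_gt0 addn1 modnDr exprS mulrCA -!mulrA.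
exact: isNF_UV.
Qed.

Lemma isNF_mulc p x : isNF x -> isNF (c p * x).
Proof.
move=> [b ->]; rewrite /NF mulr_sumr; apply: isNF_sum => i _.
by rewrite mulrA -rmorphM; apply: isNF_UV.
Qed.

Lemma isNF_mulUn n x : isNF x -> isNF (U ^+ n * x).
Proof.
elim: n => [|n IHn] NFx; first by rewrite mul1r.
by rewrite exprS -mulrA; apply/isNF_mulU/IHn.
Qed.

Lemma V_exp_d : V ^+ d = c tau * U - \sum_(i < d) c (a i) * V ^+ i.
Proof. by rewrite (pres_rel presA) addrC addKr. Qed.

Lemma UV_small i : (i < d)%N -> UV i = V ^+ i.
Proof. by move=> id; rewrite /UV divn_small // modn_small // mul1r. Qed.

Lemma isNF_mulV x : isNF x -> isNF (V * x).
Proof.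
move=> [b ->]; rewrite /NF mulr_sumr; apply: isNF_sum => i _.
rewrite mulrCA; apply: isNF_mulc; rewrite /UV mulrCA -exprS.
(* Only the remainder d - 1 needs work: it becomes V^d, which the relation rewrites. *)
apply: isNF_mulUn; have := ltn_pmod i d_gt0; rewrite leq_eqVlt => /predU1P[->|lt].
  rewrite V_exp_d; apply: isNFD.
    have -> : c tau * U = c tau * UV d.
      by rewrite /UV divnn d_gt0 modnn mulr1.
    exact: isNF_UV.
  rewrite -sumrN; apply: isNF_sum => i' _; rewrite -mulNr -rmorphN -UV_small //.
  exact: isNF_UV.
by rewrite -UV_small // -[UV _]mul1r -(rmorph1 c); apply: isNF_UV.
Qed.

(** Normal forms contain 1 and are stable under addition and under multiplication by k[T], V and
    U. *)
Lemma NF_surj x : isNF x.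
Proof.
suff : forall y, isNF y -> isNF (x * y).
  move=> h; rewrite -[x]mulr1; apply: h.
  suff -> : 1 = c 1 * UV 0 by apply: isNF_UV.
  by rewrite UV_small // expr0 mulr1 rmorph1.
elim/(pres_ind presA): x => [p|||x y hx hy z NFz|x y hx hy z NFz].
- exact: isNF_mulc.
- exact: isNF_mulV.
- exact: isNF_mulU.
- by rewrite mulrDl; apply: isNFD; [apply: hx | apply: hy].
by rewrite -mulrA; apply/hx/hy.
Qed.

Lemma iota_eq0 x : (iota x == 0) = (x == 0).
Proof.
apply/eqP/eqP => [|->]; last exact: rmorph0.
have [b ->] := NF_surj x => e.
have [] := iota_NF b; rewrite e size_poly0 => /esym/eqP; rewrite size_poly_eq0.
by move=> /eqP-> _; rewrite /NF size_poly0 big_ord0.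
Qed.

Lemma pres_mulf_eq0 (x y : A) : (x * y == 0) = (x == 0) || (y == 0).
Proof. by rewrite -iota_eq0 rmorphM mulf_eq0 !iota_eq0. Qed.

Lemma c_eq0 p : (c p == 0) = (p == 0).
Proof. by rewrite -iota_eq0 iota_c polyC_eq0 j_eq0. Qed.

Lemma c_inj : injective c.
Proof. by move=> p q /eqP; rewrite -subr_eq0 -rmorphB c_eq0 subr_eq0 => /eqP. Qed.

Lemma size_iota_le1 x : (size (iota x) <= 1)%N -> exists p, x = c p.
Proof.
have [b ->] := NF_surj x; have [-> _] := iota_NF b => sb.
exists b`_0; rewrite (NF_wide sb) big_ord1 UV_small //=.
by rewrite mulr1.
Qed.

Lemma iota_horner (q : {poly R}) :
  iota (map_poly c q).[V] = map_poly (j) q.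
Proof.
rewrite horner_poly rmorph_sum /= [RHS]poly_def /=; apply: eq_bigr => i _.
by rewrite rmorphM rmorphXn /= iota_V iota_c mul_polyC.
Qed.

(** After inverting T^r the algebra becomes polynomial in V; every element has a power of T^r as
    denominator. *)
Lemma denom x : exists n (q : {poly R}), c tau ^+ n * x = (map_poly c q).[V].
Proof.
elim/(pres_ind presA): x => [p|||x y [n [q hx]] [n' [q' hy]]|x y [n [q hx]] [n' [q' hy]]].
- by exists 0%N, p%:P; rewrite map_polyC hornerC mul1r.
- by exists 0%N, 'X; rewrite map_polyX hornerX mul1r.
- exists 1%N, (\sum_(i < d) (a i)%:P * 'X^i + 'X^d); rewrite expr1 (pres_rel presA).
  rewrite rmorphD /= map_polyXn rmorph_sum hornerD horner_sum hornerXn /=; congr (_ + _).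
  by apply: eq_bigr => i _; rewrite rmorphM /= map_polyXn map_polyC hornerM hornerC hornerXn.
- exists (n + n')%N, ((tau ^+ n')%:P * q + (tau ^+ n)%:P * q').
  rewrite rmorphD !rmorphM /= !map_polyC hornerD !hornerM !hornerC -hx -hy /= !rmorphXn /=.
  by rewrite exprD; ring.
exists (n + n')%N, (q * q'); rewrite rmorphM hornerM -hx -hy exprD; ring.
Qed.

End LaurentEmbedding.

(** * Stable isomorphism *)

Section PolynomialPresentation.
Variables (k : fieldType) (m d : nat) (a : 'I_d -> {mpoly k[m]}).
Local Notation R := {mpoly k[m]}.
Variable r : m.-tuple nat.
Local Notation tau := (monoT k r).

(** What is used of B[Z]: its universal property, and regularity of nonzero elements of k[T], by
    which identities are checked after multiplication by T^r or g. *)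
Record poly_presentation (S : comAlgType k) (c : {rmorphism R -> S}) (V U Z : S) : Prop :=
  PolyPresentation {
  ppres_const : forall x, c x%:MP = x%:A;
  ppres_rel : c tau * U = evalV c V (Fpoly a);
  ppres_reg : forall p x, p != 0 -> c p * x = 0 -> x = 0;
  ppres_ext : forall (T : comNzRingType) (f g : {rmorphism S -> T}),
    (forall p, f (c p) = g (c p)) -> f V = g V -> f U = g U -> f Z = g Z -> f =1 g;
  ppres_lift : forall (T : comNzRingType) (f : {rmorphism R -> T}) (x u z : T),
    f tau * u = evalV f x (Fpoly a) -> exists g : {rmorphism S -> T},
    [/\ forall p, g (c p) = f p, g V = x, g U = u & g Z = z] }.

Lemma poly1_presentation (A : comAlgType k) (c : {rmorphism R -> A}) V U :
  (0 < d)%N -> presentation a r c V U ->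
  poly_presentation (S := poly1 A) (polyC \o c) V%:P U%:P 'X.
Proof.
move=> d0 presA; split.
- move=> x; rewrite /= (pres_const presA) /GRing.scale /= /poly1_scale.
  by rewrite mulr1.
- rewrite -(@evalV_morph k m A (poly1 A) c (polyC \o c) (@polyC A) V) // evalV_Fpoly.
  by rewrite -(pres_rel presA) rmorphM.
- move=> p x p0 /= e; apply/polyP => i; rewrite coef0; apply/eqP.
  have /eqP := congr1 (fun q : {poly A} => q`_i) e; rewrite coefCM coef0.
  rewrite (pres_mulf_eq0 d0 presA (@tofrac_eq0 R)).
  by rewrite (c_eq0 d0 presA (@tofrac_eq0 R)) (negPf p0).
- move=> T f g fgc fgV fgU fgX p.
  have fgC (y : A) : f y%:P = g y%:P.
    elim/(pres_ind presA): y => [q|||y z hy hz|y z hy hz] //.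
    + exact: fgc.
    + by rewrite polyCD !rmorphD hy hz.
    + by rewrite polyCM !rmorphM hy hz.
  elim/poly_ind: p => [|p y IHp]; first by rewrite !rmorph0.
  by rewrite !rmorphD !rmorphM /= IHp fgX fgC.
move=> T f x u z rel.
have [|g [gc gV gU]] := pres_lift presA (f := f) (x := x) (u := u).
  by rewrite rel evalV_Fpoly.
pose h (p : {poly A}) := (map_poly g p).[z].
have hB : zmod_morphism h by move=> p q; rewrite /h rmorphB hornerD hornerN.
have hM : monoid_morphism h.
  by split=> [|p q]; rewrite /h ?rmorph1 ?hornerC // rmorphM hornerM.
pose h' : {rmorphism poly1 A -> T} := HB.pack (h : poly1 A -> T)
  (GRing.isZmodMorphism.Build _ _ (h : poly1 A -> T) hB)
  (GRing.isMonoidMorphism.Build _ _ (h : poly1 A -> T) hM).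
have hC y : h y%:P = g y by rewrite /h map_polyC hornerC.
exists h'; split=> [p|||].
- exact: etrans (hC (c p)) (gc p).
- exact: etrans (hC V) gV.
- exact: etrans (hC U) gU.
by rewrite /= /h map_polyX hornerX.
Qed.
End PolynomialPresentation.

Section StableIsomorphism.
Variables (k : fieldType) (m d : nat) (a : 'I_d -> {mpoly k[m]}).
Local Notation R := {mpoly k[m]}.
Local Notation F := (Fpoly a).
Variables (ua va : {poly R}).
Hypothesis unitF : ua * F + va * F^`() = 1.
(* r <= s <= 2 r, with g = T^(s-r) and q = T^(2r-s). As g divides T^r, the     *)
(* equation T^s U' = F(V + T^r Z) is linear in Z modulo g.                     *)
Variables (r s : m.-tuple nat) (g q : R).
Hypothesis tau_s : monoT k s = monoT k r * g.
Hypothesis tau_r : monoT k r = g * q.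
Variables (S : comAlgType k) (c : {rmorphism R -> S}) (V U Y : S).
Hypothesis presS : poly_presentation a r c V U Y.
Variables (S' : comAlgType k) (c' : {rmorphism R -> S'}) (V' U' Z : S').
Hypothesis presS' : poly_presentation a s c' V' U' Z.

Lemma evalV_unit (T : comNzRingType) (f : {rmorphism R -> T}) x :
  evalV f x ua * evalV f x F + evalV f x va * evalV f x F^`() = 1.
Proof. by rewrite /evalV -!hornerM -hornerD -!rmorphM -rmorphD unitF rmorph1 hornerC. Qed.

Lemma cancel_reg (b : m.-tuple nat) (T : comAlgType k) (f : {rmorphism R -> T}) v u z (p : R) x y :
  poly_presentation a b f v u z -> p != 0 -> f p * x = f p * y -> x = y.
Proof.
move=> presT p0 /eqP; rewrite -subr_eq0 -mulrBr => /eqP /(ppres_reg presT p0) /eqP.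
by rewrite subr_eq0 => /eqP.
Qed.

Lemma factor_neq0 : [/\ monoT k r != 0, monoT k s != 0 & g != 0].
Proof.
split; try exact: monoT_neq0.
by apply: contraNneq (monoT_neq0 k r) => g0; rewrite tau_r g0 mul0r.
Qed.

(** With t = T^r, z is needed such that F(V + t z) is divisible by t g. Modulo g, F(V + t z) / t is
    U + F'(V) z, and v(V) inverts F'(V) because u F = u t U is a multiple of g; hence z = - v(V) U +
    g Y. *)
Lemma forward_map : exists f : {rmorphism S' -> S},
  [/\ forall p, f (c' p) = c p, f Z = - evalV c V va * U + c g * Y
    & f V' = V + c (monoT k r) * f Z].
Proof.
pose z := - evalV c V va * U + c g * Y; pose t := c (monoT k r).
have [H taylor] := evalV_taylor c V (t * z) F.
have eF : evalV c V F = t * U by rewrite /t (ppres_rel presS).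
have et : t = c g * c q by rewrite /t tau_r rmorphM.
have eu := evalV_unit c V.
pose u := c q * evalV c V ua * U ^+ 2 + evalV c V F^`() * Y + c q * z ^+ 2 * H.
have [|f [fc fV fU fZ]] := ppres_lift presS' (f := c) (x := V + t * z) (u := u) z.
  rewrite taylor tau_s rmorphM -/t; apply/esym/eqP; rewrite -subr_eq0; apply/eqP.
  rewrite eF in eu *; rewrite et in eu *.
  transitivity (c g * c q * U * (1 - (evalV c V ua * (c g * c q * U) +
      evalV c V va * evalV c V F^`()))); last by rewrite eu subrr mulr0.
  by rewrite /u /z; ring.
by exists f; split=> //; rewrite fZ.
Qed.

(** Inverting [forward_map] requires Z + v(V0) U0 to be divisible by g, where V0 = V' - t Z and t U0
    = F(V0). Expanding F at V0 gives g U' = U0 + F'(V0) Z + t Z^2 H2; multiplying by v(V0) and using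
    u F + v F' = 1 exhibits the quotient [Y0]. *)
Lemma backward_map : exists f : {rmorphism S -> S'},
  [/\ forall p, f (c p) = c' p, f V = V' - c' (monoT k r) * Z
    & c' g * f Y = Z + evalV c' (f V) va * f U].
Proof.
have [r0 s0 g0] := factor_neq0.
pose t := c' (monoT k r); pose V0 := V' - t * Z.
have eF' : evalV c' V' F = t * (c' g * U').
  by rewrite -(ppres_rel presS') tau_s rmorphM mulrA.
have et : t = c' g * c' q by rewrite /t tau_r rmorphM.
have [H1 taylor1] := evalV_taylor c' V' (- (t * Z)) F.
pose U0 := c' g * U' - evalV c' V' F^`() * Z + t * Z ^+ 2 * H1.
have eF0 : t * U0 = evalV c' V0 F by rewrite taylor1 eF' /U0; ring.
have [H2 taylor2] := evalV_taylor c' V0 (t * Z) F.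
have eU0 : U0 + evalV c' V0 F^`() * Z + t * Z ^+ 2 * H2 = c' g * U'.
  apply: (cancel_reg presS' r0); rewrite -/t -eF'.
  have <- : V0 + t * Z = V' by rewrite subrK.
  by rewrite taylor2 -eF0; ring.
have eu := evalV_unit c' V0.
pose Y0 := evalV c' V0 va * U' + c' q * evalV c' V0 ua * U0 * Z
  - c' q * evalV c' V0 va * Z ^+ 2 * H2.
have [f [fc fV fU fY]] := ppres_lift presS Y0 eF0.
exists f; split=> //; rewrite fY fV fU.
rewrite -eF0 in eu; transitivity (evalV c' V0 va * (c' g * U') +
    (c' g * c' q) * evalV c' V0 ua * U0 * Z - (c' g * c' q) * evalV c' V0 va * Z ^+ 2 * H2).
  by rewrite /Y0; ring.
rewrite -eU0 -et; transitivity (evalV c' V0 va * U0 + (evalV c' V0 ua * (t * U0) +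
  evalV c' V0 va * evalV c' V0 F^`()) * Z); first by ring.
by rewrite eu; ring.
Qed.

(** The composites are computed directly on V', Z and V. On U', U and Y they follow from the
    relations, after cancelling T^s, T^r and g. *)
Lemma stable_isomorphism : alg_isomorphic S' S.
Proof.
have [r0 s0 g0] := factor_neq0.
have [f [fc fZ fV]] := forward_map; have [h [hc hV hY]] := backward_map.
have hfZ : h (f Z) = Z.
  rewrite fZ rmorphD !rmorphM rmorphN (evalV_morph (f' := c')) //= hc hY; ring.
have hfV : h (f V') = V' by rewrite fV rmorphD rmorphM /= hc hfZ hV subrK.
have hfU : h (f U') = U'.
  apply: (cancel_reg presS' s0); rewrite -{1}hc -{1}fc -!rmorphM (ppres_rel presS').
  by rewrite (evalV_morph (f' := c)) // (evalV_morph (f' := c')) // hfV.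
have hfK : cancel f h.
  apply: (ppres_ext presS' (f := h \o f) (g := idfun)) => //= p.
  by rewrite fc hc.
have fhV : f (h V) = V by rewrite hV rmorphB rmorphM /= fc fV addrK.
have fhU : f (h U) = U.
  apply: (cancel_reg presS r0); rewrite -{1}fc -{1}hc -!rmorphM (ppres_rel presS).
  by rewrite (evalV_morph (f' := c')) // (evalV_morph (f' := c)) // fhV.
have fhY : f (h Y) = Y.
  apply: (cancel_reg presS g0); rewrite -{1}fc -rmorphM hY rmorphD rmorphM /=.
  by rewrite (evalV_morph (f' := c)) // fhV fhU fZ; ring.
have fhK : cancel h f.
  apply: (ppres_ext presS (f := f \o h) (g := idfun)) => //= p.
  by rewrite hc fc.
have fS : scalable f.
  move=> x y; rewrite -mulr_algl -(ppres_const presS') rmorphM fc (ppres_const presS).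
  by rewrite mulr_algl.
pose f' : {lrmorphism S' -> S} := HB.pack (f : S' -> S) (GRing.RMorphism.on f)
   (GRing.isScalable.Build _ _ _ _ (f : S' -> S) fS).
by exists f'; exists h.
Qed.
End StableIsomorphism.

Section StablePart.
Variables (k : fieldType) (m d : nat) (a : 'I_d -> {mpoly k[m]}).
Local Notation R := {mpoly k[m]}.

Lemma unit_ideal_Fpoly : generate_unit_ideal (polyF a) (polyF' a) ->
  exists u v, u * Fpoly a + v * (Fpoly a)^`() = 1.
Proof.
move=> /(_ 1) [u [v uv]].
pose f : {rmorphism k -> {poly R}} := polyC \o @mpolyC m k.
pose t i : {poly R} := ('X_i)%:P.
pose h : {rmorphism {mpoly k[m.+1]} -> {poly R}} := mmap f (ext t 'X).
have hw (p : R) : h (mwiden p) = p%:P.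
  apply: (etrans (mmap_mwiden f t 'X p)).
  exact: (mmap_morph (@polyC R : {rmorphism R -> {poly R}}) p).
have hX : h 'X_ord_max = 'X by rewrite /h /= mmapX mmap1U ext_max.
have hF : h (polyF a) = Fpoly a.
  rewrite /polyF /Fpoly rmorphD rmorph_sum rmorphXn /= hX; congr (_ + _).
  by apply: eq_bigr => i _; rewrite (rmorphM h) (rmorphXn h) /= hX hw.
have hF' : h (polyF' a) = (Fpoly a)^`().
  rewrite /polyF' /Fpoly derivD raddf_sum /= derivXn rmorphD rmorph_sum (rmorphM h) (rmorphXn h).
  rewrite (rmorph_nat h) hX mulr_natl; congr (_ + _); apply: eq_bigr => i _.
  rewrite !(rmorphM h) (rmorphXn h) (rmorph_nat h) /= hX hw derivM derivC mul0r add0r derivXn.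
  by rewrite -mulr_natr; ring.
exists (h u), (h v).
have := congr1 h uv.
by rewrite (rmorph1 h) (rmorphD h) (rmorphM h u) (rmorphM h v) hF hF'.
Qed.

Lemma alg_isomorphic_sym (A A' : algType k) : alg_isomorphic A A' -> alg_isomorphic A' A.
Proof.
move=> [f [g fK gK]].
have gB : zmod_morphism g.
  by move=> x y; rewrite -{1}[x]gK -{1}[y]gK -rmorphB fK.
have gM : monoid_morphism g.
  split=> [|x y]; first by rewrite -(rmorph1 f) fK.
  by rewrite -{1}[x]gK -{1}[y]gK -rmorphM fK.
have gS : scalable g by move=> x y; rewrite -{1}[y]gK -linearZ fK.
pose g' : {lrmorphism A' -> A} := HB.pack (g : A' -> A)
  (GRing.isZmodMorphism.Build _ _ (g : A' -> A) gB)
  (GRing.isMonoidMorphism.Build _ _ (g : A' -> A) gM)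
  (GRing.isScalable.Build _ _ _ _ (g : A' -> A) gS).
by exists g'; exists f.
Qed.

Lemma alg_isomorphic_trans (A1 A2 A3 : algType k) :
  alg_isomorphic A1 A2 -> alg_isomorphic A2 A3 -> alg_isomorphic A1 A3.
Proof.
move=> [f fbij] [g gbij].
exists (g \o f : {lrmorphism A1 -> A3}); exact: bij_comp.
Qed.

Definition half_up (r : m.-tuple nat) : m.-tuple nat := [tuple uphalf (tnth r i) | i < m].

(** With h = [half_up r] one has h <= r <= 2 h, so [stable_isomorphism] applies with h as smaller
    exponent, g = T^(r-h) and q = T^(2h-r). *)
Lemma stable_half (u v : {poly R}) (r : m.-tuple nat) : (0 < d)%N ->
  u * Fpoly a + v * (Fpoly a)^`() = 1 -> all (fun e => 0 < e)%N r ->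
  alg_isomorphic (poly1 (B a r)) (poly1 (B a (half_up r))).
Proof.
move=> d0 uv /all_tnthP r0.
pose g : R := \prod_i 'X_i ^+ (tnth r i - uphalf (tnth r i)).
pose q : R := \prod_i 'X_i ^+ ((uphalf (tnth r i)).*2 - tnth r i).
have le1 i : (uphalf (tnth r i) <= tnth r i)%N by have := r0 i => /=; lia.
have le2 i : (tnth r i <= (uphalf (tnth r i)).*2)%N by lia.
have e1 : monoT k r = monoT k (half_up r) * g.
  rewrite /monoT /g -big_split; apply: eq_bigr => i _ /=.
  by rewrite -exprD tnth_mktuple subnKC.
have e2 : monoT k (half_up r) = g * q.
  rewrite /monoT /g /q -big_split; apply: eq_bigr => i _ /=.
  by rewrite -exprD tnth_mktuple; congr (_ ^+ _); have := le1 i; have := le2 i; lia.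
exact: (stable_isomorphism uv e1 e2
  (poly1_presentation d0 (B_presentation a (half_up r)))
  (poly1_presentation d0 (B_presentation a r))).
Qed.

(** Halving rounded up fixes 1 and strictly lowers larger exponents, so induction on the sum of the
    exponents ends at (1, ..., 1). *)
Lemma stable_ones (r : m.-tuple nat) : (0 < d)%N ->
  generate_unit_ideal (polyF a) (polyF' a) -> all (fun e => 0 < e)%N r ->
  alg_isomorphic (poly1 (B a r)) (poly1 (B a [tuple 1%N | i < m])).
Proof.
move=> d0 /unit_ideal_Fpoly [u [v uv]].
have [n] := ubnP (\sum_i tnth r i)%N; elim: n r => // n IHn r rn r0.
have [/allP r1|] := boolP (all (fun e => e <= 1)%N r).
  have -> : r = [tuple 1%N | i < m].
    apply: eq_from_tnth => i; rewrite tnth_mktuple; apply/eqP.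
    by rewrite eqn_leq r1 ?mem_tnth //; move/all_tnthP: r0; apply.
  by exists idfun; exists idfun.
rewrite -has_predC => /hasP[_ /tnthP[i ->]] /=; rewrite -ltnNge => ri.
apply: (alg_isomorphic_trans (stable_half d0 uv r0)); apply: IHn.
  rewrite ltnS in rn; apply: leq_trans rn.
  rewrite (bigD1 i) //= [X in (_ < X)%N](bigD1 i) //= tnth_mktuple -addSn.
  apply: leq_add; first by lia.
  by apply: leq_sum => j _; rewrite tnth_mktuple; lia.
apply/all_tnthP => j; rewrite tnth_mktuple /=; move/all_tnthP/(_ j): r0 => /=; lia.
Qed.

Lemma stable_isomorphic (r s : m.-tuple nat) : (0 < d)%N ->
  generate_unit_ideal (polyF a) (polyF' a) ->
  all (fun e => 0 < e)%N r -> all (fun e => 0 < e)%N s ->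
  alg_isomorphic (poly1 (B a r)) (poly1 (B a s)).
Proof.
move=> d0 unitF r0 s0; apply: (alg_isomorphic_trans (stable_ones d0 unitF r0)).
exact/alg_isomorphic_sym/stable_ones.
Qed.
End StablePart.

(** * The degree function and invariants *)

Section MonomialValuation.
Variable m : nat.
Implicit Types (mu nu : 'X_{1..m}).

Lemma lead_coef_at (p : {poly rat}) n : 0 < p`_n -> (forall e, (n < e)%N -> p`_e = 0) ->
  0 < lead_coef p.
Proof.
move=> pn pz; suff sz : size p = n.+1 by rewrite lead_coefE sz.
apply/eqP; rewrite eqn_leq; apply/andP; split; first exact/leq_sizeP/pz.
by rewrite ltnNge; apply/negP => /leq_sizeP/(_ n (leqnn n)) e; rewrite e ltxx in pn.
Qed.

(* Orders monomials by the degree in V, then by the order underlying [mlead]. *)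
Definition mval (i : nat) mu : {poly rat} :=
  i%:R *: 'X^(m.+1) + ((mdeg mu)%:R *: 'X^m + \sum_(j < m) (mu j)%:R *: 'X^(m.-1 - j)).

Lemma mvalD i i' mu nu : mval (i + i') (mu + nu)%MM = mval i mu + mval i' nu.
Proof.
rewrite /mval natrD mdegD natrD.
rewrite (eq_bigr (fun j : 'I_m => (mu j)%:R *: 'X^(m.-1 - j) +
  (nu j)%:R *: 'X^(m.-1 - j) : {poly rat})).
  by rewrite big_split !scalerDl /=; ring.
by move=> j _; rewrite mnmDE natrD scalerDl.
Qed.

Lemma mval0 : mval 0 0%MM = 0.
Proof.
rewrite /mval mdeg0 !scale0r !add0r big1 // => j _.
by rewrite mnm0E scale0r.
Qed.

Lemma mval_sum (I : Type) (s : seq I) (P : pred I) (F : I -> 'X_{1..m}) :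
  mval 0 (\sum_(i <- s | P i) F i)%MM = \sum_(i <- s | P i) mval 0 (F i).
Proof.
apply: (big_morph (mval 0)) => [mu nu|]; [exact: (mvalD 0 0) | exact: mval0].
Qed.

Lemma mval_mulmn e mu : mval 0 (mu *+ e)%MM = e%:R *: mval 0 mu.
Proof.
elim: e => [|e IHe]; first by rewrite mulm0n mval0 scale0r.
by rewrite mulmS (mvalD 0 0) IHe -natr1 scalerDl scale1r addrC.
Qed.

Lemma mvalE i mu : mval i mu = i%:R *: mval 1 0%MM + \sum_j (mu j)%:R *: mval 0 U_(j)%MM.
Proof.
have -> : \sum_j (mu j)%:R *: mval 0 U_(j)%MM = mval 0 mu.
  rewrite [in RHS](multinomUE_id mu) mval_sum.
  by apply: eq_bigr => j _; rewrite mval_mulmn.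
have -> : i%:R *: mval 1 0%MM = mval i 0%MM.
  elim: i => [|i IHi]; first by rewrite scale0r mval0.
  by rewrite -addn1 natrD scalerDl scale1r IHi -mvalD addm0.
by rewrite -mvalD addn0 add0m.
Qed.

Lemma coef_mval_V i mu : (mval i mu)`_m.+1 = i%:R.
Proof.
rewrite /mval !coefD !coefZ !coefXn eqxx mulr1 gtn_eqF // mulr0 add0r coef_sum.
rewrite big1 ?addr0 // => j _; rewrite coefZ coefXn gtn_eqF ?mulr0 //.
by have := ltn_ord j; lia.
Qed.

Lemma coef_mval_deg i mu : (mval i mu)`_m = (mdeg mu)%:R.
Proof.
rewrite /mval !coefD !coefZ !coefXn eqxx mulr1 ltn_eqF // mulr0 add0r coef_sum.
rewrite big1 ?addr0 // => j _; rewrite coefZ coefXn gtn_eqF ?mulr0 //.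
by have := ltn_ord j; lia.
Qed.

Lemma coef_mval_var i mu (l : 'I_m) : (mval i mu)`_(m.-1 - l) = (mu l)%:R.
Proof.
have lm := ltn_ord l.
rewrite /mval !coefD !coefZ !coefXn !ltn_eqF ?mulr0 ?add0r; [|by lia..].
rewrite coef_sum (bigD1 l) //= coefZ coefXn eqxx mulr1 big1 ?addr0 // => j jl.
have jm := ltn_ord j.
rewrite coefZ coefXn; case: eqP => [e|_]; last by rewrite mulr0.
by case/eqP: jl; apply: val_inj => /=; lia.
Qed.

Lemma coef_mval_big i mu e : (m.+1 < e)%N -> (mval i mu)`_e = 0.
Proof.
move=> me; rewrite /mval !coefD !coefZ !coefXn !gtn_eqF ?mulr0 ?add0r //; last exact: ltnW.
rewrite coef_sum big1 // => j _; rewrite coefZ coefXn gtn_eqF ?mulr0 //.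
by have := ltn_ord j; lia.
Qed.

Lemma glt_coef_V (x y : {poly rat}) : x`_m.+1 < y`_m.+1 ->
  (forall e, (m.+1 < e)%N -> x`_e = 0) -> (forall e, (m.+1 < e)%N -> y`_e = 0) -> glt x y.
Proof.
move=> xy hx hy; apply: (@lead_coef_at _ m.+1) => [|e me]; rewrite coefB ?subr_gt0 //.
by rewrite hx // hy // subr0.
Qed.

Lemma mval_lt_V i i' mu nu : (i < i')%N -> glt (mval i mu) (mval i' nu).
Proof.
move=> ii'; apply: glt_coef_V; rewrite ?coef_mval_V ?ltr_nat //;
  by move=> e me; apply: coef_mval_big.
Qed.

Lemma mval_lt i mu nu : (mu < nu)%O -> glt (mval i mu) (mval i nu).
Proof.
move=> lt; have : (mdeg mu <= mdeg nu)%N by apply: lemc_mdeg (ltW lt).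
have above e : (m < e)%N -> (mval i nu - mval i mu)`_e = 0.
  rewrite coefB leq_eqVlt => /predU1P[<-|me]; first by rewrite !coef_mval_V subrr.
  by rewrite !coef_mval_big ?subrr.
rewrite leq_eqVlt => /predU1P[dE|dlt]; last first.
  apply: (@lead_coef_at _ m) => //.
  by rewrite coefB !coef_mval_deg subr_gt0 ltr_nat.
have [l eql ltl] := ltmcP dE lt.
apply: (@lead_coef_at _ (m.-1 - l)) => [|e].
  by rewrite coefB !coef_mval_var subr_gt0 ltr_nat.
have lm := ltn_ord l; case: (ltngtP e m) => [em le|me _|-> _].
- have em' : (m.-1 - e < m)%N by lia.
  have -> : e = (m.-1 - Ordinal em')%N by rewrite /=; lia.
  by rewrite coefB !coef_mval_var eql ?subrr //=; lia.
- exact: above.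
by rewrite coefB !coef_mval_deg dE subrr.
Qed.

Lemma mval_le i mu nu : (mu <= nu)%O -> gle (mval i mu) (mval i nu).
Proof.
rewrite le_eqVlt => /predU1P[->|/(mval_lt i)/gltW //]; exact: gle_refl.
Qed.

Lemma mval_inj i i' mu nu : mval i mu = mval i' nu -> i = i' /\ mu = nu.
Proof.
move=> e; have ii' : i = i'.
  by apply/eqP; rewrite -(eqr_nat rat) -(coef_mval_V i mu) e coef_mval_V.
split=> //; case: (ltgtP mu nu) => // /(mval_lt i); rewrite e ii' glt_irr //.
Qed.

Variable k : fieldType.
Local Notation R := {mpoly k[m]}.
Implicit Types p q : {poly R}.

Definition pdeg q : {poly rat} := mval (size q).-1 (mlead (lead_coef q)).

Lemma pdegM p q : p != 0 -> q != 0 -> pdeg (p * q) = pdeg p + pdeg q.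
Proof.
move=> p0 q0; rewrite /pdeg lead_coefM mleadM ?lead_coef_eq0 // size_mul // -mvalD.
move: p0 q0; rewrite -!size_poly_gt0; case: (size p) => // n _; case: (size q) => // n' _.
by rewrite addSn addnS.
Qed.

Lemma pdeg_supp q i mu : q`_i@_mu != 0 -> gle (mval i mu) (pdeg q).
Proof.
move=> nz; have iq : (i < size q)%N.
  by rewrite ltnNge; apply: contraNN nz => ?; rewrite nth_default // mcoeff0.
rewrite /pdeg; case: (ltngtP i (size q).-1) => [lt|lt|e].
- exact/gltW/mval_lt_V.
- by move: iq lt; lia.
rewrite -e; apply: mval_le; apply: msupp_le_mlead.
by rewrite mcoeff_msupp lead_coefE -e.
Qed.

Lemma pdeg_top q : q != 0 -> q`_(size q).-1@_(mlead (lead_coef q)) != 0.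
Proof. by move=> q0; rewrite -lead_coefE mleadc_eq0 lead_coef_eq0. Qed.

Lemma pdegD g p q : p + q != 0 -> (p = 0 \/ gle (pdeg p) g) -> (q = 0 \/ gle (pdeg q) g) ->
  gle (pdeg (p + q)) g.
Proof.
move=> pq0 hp hq; have := pdeg_top pq0.
set i := (size _).-1; set mu := mlead _; rewrite coefD mcoeffD => nz.
have [z|nzp] := eqVneq (p`_i@_mu) 0.
  rewrite z add0r in nz; have h := pdeg_supp nz.
  by case: hq => [q0|]; [rewrite q0 coef0 mcoeff0 eqxx in nz | apply: gle_trans].
have h := pdeg_supp nzp.
by case: hp => [p0|]; [rewrite p0 coef0 mcoeff0 eqxx in nzp | apply: gle_trans].
Qed.

Lemma pdeg_leaf p q : p != 0 -> q != 0 -> pdeg p = pdeg q ->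
  exists c : k, p - c%:MP%:P * q = 0 \/ glt (pdeg (p - c%:MP%:P * q)) (pdeg p).
Proof.
move=> p0 q0 e; have [ei emu] := mval_inj e.
set i := (size p).-1 in ei; set mu := mlead (lead_coef p) in emu.
have pt := pdeg_top p0; have qt := pdeg_top q0; rewrite -ei -emu in qt.
(* The quotient of the two coefficients at the common top monomial cancels it. *)
rewrite -/i -/mu in pt; exists (p`_i@_mu / q`_i@_mu).
set c := _ / _; set s := p - _; have [->|s0] := eqVneq s 0; [by left | right].
have cE j nu : s`_j@_nu = p`_j@_nu - c * q`_j@_nu.
  by rewrite coefB coefCM mcoeffB mcoeffCM.
have := pdeg_top s0; set j := (size s).-1; set nu := mlead (lead_coef s) => nz.
have : gle (pdeg s) (pdeg p).
  rewrite -[pdeg s]/(mval j nu); have [z|nzp] := eqVneq (p`_j@_nu) 0; last exact: pdeg_supp.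
  rewrite e; apply: pdeg_supp; apply: contraNN nz => /eqP zq.
  by rewrite cE z zq mulr0 subrr.
case/gle_eqVlt => // /mval_inj [jE nuE].
by move: nz; rewrite /j /nu jE nuE -/i -/mu cE /c divfK // subrr eqxx.
Qed.

End MonomialValuation.

Section PresentationDegree.
Variables (k : fieldType) (m d : nat) (a : 'I_d -> {mpoly k[m]}) (r : m.-tuple nat).
Local Notation R := {mpoly k[m]}.
Hypothesis d_gt1 : (1 < d)%N.
Let d_gt0 : (0 < d)%N := ltnW d_gt1.
Variables (A : comAlgType k) (c : {rmorphism {mpoly k[m]} -> A}) (V U : A).
Hypothesis presA : presentation a r c V U.
Variables (K : fieldType) (j : {rmorphism R -> K}).
Hypothesis j_eq0 : forall p, (j p == 0) = (p == 0).
Local Notation tau := (monoT k r).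
Local Notation iota := (iota presA j_eq0).
Implicit Types (p : R) (q b : {poly R}) (x y : A).

Definition vtau : {poly rat} := mval 0 (mlead tau).

Lemma mlead_tau : mlead tau = (\sum_i U_(i) *+ tnth r i)%MM.
Proof.
rewrite /monoT (eq_bigr (fun i : 'I_m => 'X_[U_(i) *+ tnth r i] : R)) => [|i _].
  by rewrite -(big_morph (@mpolyX m k) (@mpolyXD m k) (mpolyX0 m k)) mleadXm.
by rewrite mpolyXn.
Qed.

Lemma vtauE : vtau = \sum_i (tnth r i)%:R *: mval 0 (U_(i)%MM : 'X_{1..m}).
Proof. by rewrite /vtau mlead_tau mval_sum; apply: eq_bigr => i _; rewrite mval_mulmn. Qed.

Lemma tau_exp_neq0 n : tau ^+ n != 0.
Proof. exact/expf_neq0/monoT_neq0. Qed.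

Lemma pdeg_tau n : pdeg (tau ^+ n)%:P = n%:R *: vtau.
Proof.
rewrite /pdeg size_polyC tau_exp_neq0 lead_coefC mleadX ?monoT_neq0 //=.
by rewrite mval_mulmn.
Qed.

Lemma iota_evalV q : iota (map_poly c q).[V] = map_poly j q.
Proof. exact: iota_horner. Qed.

Lemma j_inj : injective j.
Proof. by move=> p p' /eqP; rewrite -subr_eq0 -rmorphB j_eq0 subr_eq0 => /eqP. Qed.

Lemma evalV_inj q b : (map_poly c q).[V] = (map_poly c b).[V] -> q = b.
Proof.
move=> e; have := congr1 iota e; rewrite !iota_evalV.
by apply: map_inj_poly; [exact: j_inj | rewrite rmorph0].
Qed.

Lemma evalV_eq0 q : ((map_poly c q).[V] == 0) = (q == 0).
Proof.
apply/eqP/eqP => [e|->]; last by rewrite map_poly0 horner0.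
by apply: evalV_inj; rewrite e map_poly0 horner0.
Qed.

Lemma c_tau_neq0 n : c tau ^+ n != 0.
Proof. by rewrite -rmorphXn (c_eq0 d_gt0 presA j_eq0) tau_exp_neq0. Qed.

Lemma mulf_neq0_pres x y : x != 0 -> y != 0 -> x * y != 0.
Proof. by move=> x0 y0; rewrite (pres_mulf_eq0 d_gt0 presA j_eq0) negb_or x0. Qed.

Definition denom_data x : {nq : nat * {poly R} | c tau ^+ nq.1 * x = (map_poly c nq.2).[V]}.
Proof.
apply: boolp.cid; have [n [q e]] := denom presA x.
by exists (n, q).
Qed.

(** The extension of [pdeg] from k[T][V] to A, seen inside its localisation at T^r; [pres_degE]
    shows independence of the chosen denominator. *)
Definition pres_deg x : {poly rat} :=
  pdeg (sval (denom_data x)).2 - (sval (denom_data x)).1%:R *: vtau.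

Lemma denom_neq0 n q x : c tau ^+ n * x = (map_poly c q).[V] -> (x == 0) = (q == 0).
Proof.
move=> e; rewrite -evalV_eq0 -e (pres_mulf_eq0 d_gt0 presA j_eq0).
by rewrite (negPf (c_tau_neq0 n)).
Qed.

Lemma pres_degE n q x : c tau ^+ n * x = (map_poly c q).[V] -> x != 0 ->
  pres_deg x = pdeg q - n%:R *: vtau.
Proof.
move=> e x0; rewrite /pres_deg; case: (denom_data x) => [[n' q'] /= e'].
have q0 : q != 0 by rewrite -(denom_neq0 e).
have q'0 : q' != 0 by rewrite -(denom_neq0 e').
have : (tau ^+ n)%:P * q' = (tau ^+ n')%:P * q.
  apply: evalV_inj; rewrite !rmorphM /= !map_polyC !hornerM !hornerC /= !rmorphXn -e -e'.
  by rewrite mulrCA.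
move/(congr1 (@pdeg m k)); rewrite !pdegM ?polyC_eq0 ?tau_exp_neq0 // !pdeg_tau => h.
have -> : pdeg q' = n'%:R *: vtau + pdeg q - n%:R *: vtau by rewrite -h; ring.
by ring.
Qed.

Lemma denom2 x y : exists n q b, c tau ^+ n * x = (map_poly c q).[V] /\
  c tau ^+ n * y = (map_poly c b).[V].
Proof.
have [n [q e]] := denom presA x; have [n' [b e']] := denom presA y.
exists (n + n')%N, ((tau ^+ n')%:P * q), ((tau ^+ n)%:P * b).
rewrite !rmorphM /= !map_polyC !hornerM !hornerC /= !rmorphXn -e -e'.
by rewrite exprD; split; ring.
Qed.

Lemma pres_degree_function : degree_function pres_deg.
Proof.
split.
- move=> x y x0 y0; have xy0 := mulf_neq0_pres x0 y0; split=> //.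
  have [n [q [b [e e']]]] := denom2 x y.
  have e2 : c tau ^+ (n + n) * (x * y) = (map_poly c (q * b)).[V].
    by rewrite rmorphM hornerM -e -e' exprD; ring.
  rewrite (pres_degE e x0) (pres_degE e' y0) (pres_degE e2 xy0) pdegM.
  + by rewrite natrD scalerDl; ring.
  + by rewrite -(denom_neq0 e).
  + by rewrite -(denom_neq0 e').
- move=> g x y hx hy; have [->|xy0] := eqVneq (x + y) 0; [by left | right].
  have [n [q [b [e e']]]] := denom2 x y.
  have e2 : c tau ^+ n * (x + y) = (map_poly c (q + b)).[V].
    by rewrite rmorphD hornerD -e -e' mulrDr.
  rewrite (pres_degE e2 xy0) -[g](addrK (n%:R *: vtau)) gleDr.
  have hz z s : c tau ^+ n * z = (map_poly c s).[V] -> dle pres_deg g z ->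
      s = 0 \/ gle (pdeg s) (g + n%:R *: vtau).
    move=> ez; have [z0 _|z0] := eqVneq z 0.
      by left; apply/eqP; rewrite -(denom_neq0 ez) z0.
    case=> [/eqP|]; first by rewrite (negPf z0).
    rewrite (pres_degE ez z0) => h; right; move: h.
    by rewrite -{1}[g](addrK (n%:R *: vtau)) gleDr.
  apply: pdegD; first by rewrite -(denom_neq0 e2).
  + exact: hz e hx.
  + exact: hz e' hy.
- move=> e e0; have e1 : c tau ^+ 0 * e%:A = (map_poly c (e%:MP)%:P).[V].
    by rewrite mul1r map_polyC hornerC /= (pres_const presA).
  have eP0 : (e%:MP : R) != 0 by rewrite mpolyC_eq0.
  rewrite (pres_degE e1) ?scale0r ?subr0; last first.
    by rewrite (denom_neq0 e1) polyC_eq0.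
  by rewrite /pdeg size_polyC eP0 lead_coefC mleadC mval0.
move=> x y x0 y0 dxy; have [n [q [b [e e']]]] := denom2 x y.
have q0 : q != 0 by rewrite -(denom_neq0 e).
have b0 : b != 0 by rewrite -(denom_neq0 e').
move: dxy; rewrite (pres_degE e x0) (pres_degE e' y0) => /addIr dqb.
have [l hl] := pdeg_leaf q0 b0 dqb; exists l.
have e2 : c tau ^+ n * (x - l *: y) = (map_poly c (q - l%:MP%:P * b)).[V].
  rewrite rmorphB rmorphM /= map_polyC hornerD hornerN hornerM hornerC -e -e' /=.
  by rewrite (pres_const presA) mulrBr -scalerAr mulr_algl.
have [->|xy0] := eqVneq (x - l *: y) 0; [by left | right].
rewrite (pres_degE e2 xy0); case: hl => [z|lt].
  by rewrite (denom_neq0 e2) z eqxx in xy0.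
exact: glt_leD lt (gle_refl _).
Qed.

Lemma pres_deg_c p : p != 0 -> pres_deg (c p) = mval 0 (mlead p).
Proof.
move=> p0; have e : c tau ^+ 0 * c p = (map_poly c p%:P).[V].
  by rewrite mul1r map_polyC hornerC.
rewrite (pres_degE e) ?scale0r ?subr0; last by rewrite (c_eq0 d_gt0 presA j_eq0).
by rewrite /pdeg size_polyC p0 lead_coefC.
Qed.

Lemma V_neq0 : V != 0.
Proof.
have e : c tau ^+ 0 * V = (map_poly c 'X).[V] by rewrite mul1r map_polyX hornerX.
by rewrite (denom_neq0 e) polyX_eq0.
Qed.

Lemma pres_deg_V : pres_deg V = mval 1 (0%MM : 'X_{1..m}).
Proof.
have e : c tau ^+ 0 * V = (map_poly c 'X).[V] by rewrite mul1r map_polyX hornerX.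
by rewrite (pres_degE e V_neq0) scale0r subr0 /pdeg size_polyX lead_coefX mlead1.
Qed.

(** The last term of the normal form fixes the leading coefficient of the image under [iota], hence
    the degree. Through [mval_split], every degree is thus a combination of those of T_i, U and V
    with natural coefficients. *)
Lemma pres_deg_NF x : x != 0 -> exists b, [/\ x = NF d c V U b, b != 0 &
  pres_deg x = mval (size b).-1 (mlead (lead_coef b)) - ((size b).-1 %/ d)%:R *: vtau].
Proof.
move=> x0; have [b xE] := NF_surj d_gt0 presA x; exists b.
have [sb lb] := iota_NF presA j_eq0 b; rewrite -xE in sb lb.
have b0 : b != 0.
  by rewrite -size_poly_gt0 -sb size_poly_gt0 (iota_eq0 d_gt0).
split=> //; have [n [q e]] := denom presA x.
have q0 : q != 0 by rewrite -(denom_neq0 e).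
have := congr1 iota e; rewrite iota_evalV rmorphM rmorphXn /= iota_c -polyC_exp mul_polyC => e1.
have jt := jtau_neq0 r j_eq0.
have sq : size q = size b.
  by rewrite -(size_map_inj_poly j_inj (rmorph0 j)) -e1 size_scale ?expf_neq0.
have : tau ^+ n * lead_coef b = tau ^+ ((size b).-1 %/ d) * lead_coef q.
  apply: j_inj; rewrite !rmorphM !rmorphXn /= -(lead_coef_map_inj j_inj (rmorph0 j) q) -e1.
  rewrite lead_coefZ lb; set s := (_ %/ _)%N.
  by rewrite mulrCA [j tau ^+ s * _]mulrCA divff ?expf_neq0 // mulr1.
move/(congr1 (fun p => mval 0 (mlead p))).
rewrite !mleadM ?lead_coef_eq0 ?tau_exp_neq0 // !mleadX ?monoT_neq0 //.
rewrite !(mvalD 0 0) !mval_mulmn -/vtau => h.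
rewrite (pres_degE e x0) /pdeg sq -[(size b).-1](addn0 _) -[mlead _](add0m _) mvalD.
rewrite -[X in _ = mval _ X - _](add0m _) mvalD addn0.
have -> : mval 0 (mlead (lead_coef q)) = n%:R *: vtau + mval 0 (mlead (lead_coef b)) -
    ((size b).-1 %/ d)%:R *: vtau by rewrite h; ring.
by ring.
Qed.

Lemma U_neq0 : U != 0.
Proof.
have e : c tau ^+ 1 * U = (map_poly c (Fpoly a)).[V].
  by rewrite expr1 (pres_rel presA) -evalV_Fpoly.
by have [sF _] := (size_lead_Fpoly a); rewrite (denom_neq0 e) -size_poly_gt0 sF.
Qed.

Lemma pres_deg_U : pres_deg U = d%:R *: mval 1 (0%MM : 'X_{1..m}) - vtau.
Proof.
have e : c tau ^+ 1 * U = (map_poly c (Fpoly a)).[V].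
  by rewrite expr1 (pres_rel presA) -evalV_Fpoly.
have [sF lF] := (size_lead_Fpoly a).
rewrite (pres_degE e U_neq0) /pdeg sF lF mlead1 scale1r mvalE; congr (_ - _).
by rewrite big1 ?addr0 // => i _; rewrite mnm0E scale0r.
Qed.

Lemma pres_deg_X i : pres_deg (c 'X_i) = mval 0 (U_(i)%MM : 'X_{1..m}).
Proof.
rewrite pres_deg_c ?mleadXm //.
by rewrite -msize_poly_eq0 msizeX.
Qed.

Lemma mval_split i mu : mval i mu - (i %/ d)%:R *: vtau =
  \sum_l (mu l)%:R *: pres_deg (c 'X_l) + (i %/ d)%:R *: pres_deg U
  + (i %% d)%:R *: pres_deg V.
Proof.
rewrite (eq_bigr (fun l : 'I_m => (mu l)%:R *: mval 0 U_(l)%MM)) => [|l _]; last first.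
  by rewrite pres_deg_X.
rewrite mvalE pres_deg_U pres_deg_V {1}(divn_eq i d) natrD natrM scalerDl.
by rewrite scalerBr scalerA; ring.
Qed.

Lemma coef_vtau : vtau`_m.+1 = 0.
Proof. by rewrite /vtau coef_mval_V. Qed.

Lemma mem_genX i : c 'X_i \in V :: U :: [seq c 'X_i | i <- enum 'I_m].
Proof.
by rewrite in_cons; apply/orP; right; rewrite in_cons; apply/orP; right;
  apply/mapP; exists i; rewrite ?mem_enum.
Qed.

(** There is no cancellation in a normal form: a term of lower index has lower degree in V, and one
    of top index has a monomial bounded by the leading one. *)
Lemma pres_deg_gen : generates_filtration pres_deg
  (V :: U :: [seq c 'X_i | i <- enum 'I_m]).
Proof.
move=> Q Q0 QD Qle QM Qc Qgen x x0.
have QX i : Q (pres_deg (c 'X_i)) (c 'X_i).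
  exact/Qgen/mem_genX.
have Q1 : Q 0 1 by have := Qc 1; rewrite scale1r.
have Qexp g y n : Q g y -> Q (n%:R *: g) (y ^+ n).
  move=> Qy; elim: n => [|n IHn]; first by rewrite scale0r expr0.
  by rewrite exprS -natr1 scalerDl scale1r addrC; apply: (QM).
have Qsum (I : Type) (s : seq I) (F : I -> A) g : (forall i, Q g (F i)) ->
    Q g (\sum_(i <- s) F i).
  by move=> h; apply: (big_ind (Q g)) => //; apply: QD.
have QUV i mu : Q (mval i mu - (i %/ d)%:R *: vtau) (c 'X_[mu] * UV d V U i).
  rewrite mval_split -addrA; apply: (QM); last first.
    by apply: (QM); apply: Qexp; apply: Qgen; rewrite !inE eqxx ?orbT.
  rewrite mpolyXE_id rmorph_prod; apply: (big_ind2 (fun g y => Q g y)) => //.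
    by move=> g1 y1 g2 y2; apply: QM.
  by move=> l _; rewrite rmorphXn; apply: Qexp.
have [b [xE b0 ->]] := pres_deg_NF x0; rewrite xE /NF.
apply: Qsum => i; rewrite [b`_i]mpolyE rmorph_sum mulr_suml big_seq.
apply: (big_ind (fun y => Q _ y)) => // [y z|mu mub]; first exact: QD.
rewrite -mul_mpolyC rmorphM /= -mulrA -[X in Q X]add0r; apply: (QM).
  by rewrite (pres_const presA); apply: Qc.
apply: (Qle) (QUV i mu).
have := ltn_ord i; rewrite -[X in (_ < X)%N]prednK ?size_poly_gt0 // ltnS leq_eqVlt.
case/predU1P => [iE|lt].
  rewrite -iE gleDr; apply/mval_le/msupp_le_mlead.
  by rewrite lead_coefE -iE.
apply/gltW/(@glt_coef_V m).
- by rewrite !coefB !coefZ coef_vtau !mulr0 !subr0 !coef_mval_V ltr_nat.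
- by move=> e me; rewrite coefB coefZ !coef_mval_big // mulr0 subrr.
by move=> e me; rewrite coefB coefZ !coef_mval_big // mulr0 subrr.
Qed.

(** By [fixed_degree], the degree of an invariant is that of a monomial in the T_i; degree 0 in V
    then means membership in k[T] by [size_iota_le1]. *)
Lemma fixed_in_coefs (D : nat -> A -> A) x : higher_derivation D ->
  (forall i, (1 < tnth r i)%N) ->
  (exists y n, (0 < n)%N /\ D n y != 0) ->
  (forall n, (0 < n)%N -> D n x = 0) -> exists p, x = c p.
Proof.
move=> Dhd r_gt1 [y0 [n0 [n00 Dy0]]] xfix.
have [->|x0] := eqVneq x 0; first by exists 0; rewrite rmorph0.
pose gens := V :: U :: [seq c 'X_i | i <- enum 'I_m].
(* A family trivial on all generators would be trivial everywhere by the Leibniz rule. *)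
have moved : exists y n, (0 < n)%N /\ y \in gens /\ D n y != 0.
  apply: boolp.contrapT => h.
  have fixg y n : (0 < n)%N -> y \in gens -> D n y = 0.
    move=> n1 yg; apply/eqP/negPn/negP => nz; apply: h; exists y, n; by [].
  have fixM y z : (forall n, (0 < n)%N -> D n y = 0) -> (forall n, (0 < n)%N -> D n z = 0) ->
      forall n, (0 < n)%N -> D n (y * z) = 0.
    move=> hy hz n n1; rewrite (hd_mul Dhd) big1 // => i _.
    case: (posnP i) => [->|i1]; last by rewrite hy // mul0r.
    by rewrite subn0 hz // mulr0.
  have fixX i : forall n, (0 < n)%N -> D n (c 'X_i) = 0.
    by move=> n n1; apply: fixg => //; apply: mem_genX.
  have fixall y : forall n, (0 < n)%N -> D n y = 0.
    elim/(pres_ind presA): y => [p|||y z hy hz n n1|y z hy hz].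
    - elim/mpolyind: p => [|e mu p _ _ IHp] n n1.
        by rewrite rmorph0 (hd0 Dhd).
      rewrite rmorphD (hd_add Dhd) IHp // addr0 -mul_mpolyC rmorphM (pres_const presA).
      rewrite mulr_algl (hd_scale Dhd).
      suff -> : D n (c 'X_[mu]) = 0 by rewrite scaler0.
      move: n n1; rewrite mpolyXE_id rmorph_prod.
      apply: (big_ind (fun y => forall n, (0 < n)%N -> D n y = 0)) => //.
        exact: hd_one Dhd.
      move=> i _; rewrite rmorphXn; elim: (mu i) => [|e' IHe]; first exact: hd_one Dhd.
      by rewrite exprS; apply: (fixM); [exact: fixX | exact: IHe].
    - by move=> n n1; apply: fixg => //; rewrite inE eqxx.
    - by move=> n n1; apply: fixg => //; rewrite !inE eqxx orbT.
    - by rewrite (hd_add Dhd) hy // hz // addr0.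
    exact: fixM.
  by case/eqP: Dy0; apply: fixall.
have [] := @fixed_degree k A pres_deg pres_degree_function m d (tnth r)
  (fun i => c 'X_i) V U d_gt1 r_gt1 _ V_neq0 U_neq0 _ _ _ pres_deg_gen D Dhd x moved x0 xfix.
- by move=> i; rewrite (c_eq0 d_gt0 presA j_eq0) -msize_poly_eq0 msizeX.
- rewrite pres_deg_U pres_deg_V vtauE.
  rewrite (eq_bigr (fun i : 'I_m => (tnth r i)%:R *: mval 0 (U_(i)%MM : 'X_{1..m}))) => [|i _].
    by rewrite addrC subrK.
  by rewrite pres_deg_X.
- move=> y yn0; have [b [_ _ ->]] := pres_deg_NF yn0; rewrite mval_split.
  by exists (fun i => mlead (lead_coef b) i), ((size b).-1 %/ d)%N, ((size b).-1 %% d)%N.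
- move=> e e'; rewrite pres_deg_V => h.
  have e'0 : e' = 0.
    have := congr1 (fun p : {poly rat} => p`_m.+1) h.
    rewrite coefD coefZ coef_mval_V coef0 coef_sum big1 ?add0r ?mulr1 // => i _.
    by rewrite coefZ pres_deg_X coef_mval_V mulr0.
  split=> // l; have := congr1 (fun p : {poly rat} => p`_(m.-1 - l)) h.
  rewrite e'0 scale0r addr0 coef0 coef_sum (bigD1 l) //= big1 ?addr0 => [|i il].
    by rewrite coefZ pres_deg_X coef_mval_var mnm1E eqxx mulr1.
  by rewrite coefZ pres_deg_X coef_mval_var mnm1E (negPf il) mulr0.
move=> e dx; apply: (size_iota_le1 d_gt0 (presA := presA) (j_eq0 := j_eq0)).
have [b [xE b0 dx']] := pres_deg_NF x0.
have [sb _] := iota_NF presA j_eq0 b; rewrite xE sb.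
suff : (size b).-1 = 0%N by case: (size b) => [|[]].
rewrite dx in dx'; move: dx' => /(congr1 (fun p : {poly rat} => p`_m.+1)).
rewrite coefB [in _ - _]coefZ coef_vtau mulr0 subr0 coef_mval_V coef_sum big1 => [/esym/eqP|i _].
  by rewrite pnatr_eq0 => /eqP.
by rewrite coefZ pres_deg_X coef_mval_V mulr0.
Qed.

End PresentationDegree.

(** * Isomorphisms between the algebras B *)

Section MonomialAlgebra.
Variables (k : fieldType) (m : nat).
Local Notation R := {mpoly k[m]}.

(* Counting: the n^(m+1) products of powers < n of m + 1 polynomials of degree *)
(* at most D lie in a space of dimension at most ((m+1) n D + 1)^m.           *)
Lemma algebraic_dependence (theta : {rmorphism R -> R}) (y : R) :
  (forall e, theta e%:MP = e%:MP) ->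
  exists2 q : {poly R}, q != 0 & (map_poly theta q).[y] = 0.
Proof.
move=> thetaC; pose D := (msize y + \sum_i msize (theta 'X_i))%N.
(* The choice n > L^m makes the n^(m+1) rows outnumber the (n L)^m columns, so that the rows are
   linearly dependent. *)
pose L := (m.+1 * D).+1; pose n := (L ^ m).+1; pose M := (n * L)%N.
pose row := ({ffun 'I_m -> 'I_n} * 'I_n)%type; pose col := {ffun 'I_m -> 'I_M}.
pose mon (t : row) : 'X_{1..m} := [multinom (t.1 i : nat) | i < m].
pose P (t : row) : R := theta 'X_[mon t] * y ^+ (t.2).
pose Mx : 'M[k]_(#|{: row}|, #|{: col}|) :=
  \matrix_(t, e) (P (enum_val t))@_[multinom ((enum_val e : col) i : nat) | i < m].
have msizeMp (p q : R) A B : (msize p <= A.+1)%N -> (msize q <= B.+1)%N ->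
    (msize (p * q) <= (A + B).+1)%N.
  have [-> _ _|p0] := eqVneq p 0; first by rewrite mul0r msize0.
  have [-> _ _|q0] := eqVneq q 0; first by rewrite mulr0 msize0.
  have pred2 x z : (x <= z.+2)%N -> (x.-1 <= z.+1)%N by lia.
  rewrite msizeM // => pA qB; apply: pred2.
  by rewrite -addnS -addSn; apply: leq_add.
have msizeXp (p : R) A e : (msize p <= A.+1)%N -> (msize (p ^+ e) <= (e * A).+1)%N.
  move=> pA; elim: e => [|e IHe]; first by rewrite expr0 msize1.
  by rewrite exprS mulSn; apply: (msizeMp).
have sizeP t : (msize (P t) <= M)%N.
  have yD : (msize y <= D.+1)%N by rewrite /D; lia.
  have xD i : (msize (theta 'X_i) <= D.+1)%N.
    by rewrite /D (bigD1 i) //=; lia.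
  have h : (msize (P t) <= (m * (n * D) + n * D).+1)%N.
    apply: (msizeMp).
      rewrite mpolyXE_id rmorph_prod.
      rewrite -[X in (X * _)%N]card_ord -sum_nat_const.
      apply: (big_ind2 (fun p A => (msize p <= A.+1)%N)); first by rewrite msize1.
        by move=> ? ? ? ?; apply: (msizeMp).
      move=> i _; rewrite rmorphXn; apply: leq_trans (msizeXp _ _ _ (xD i)) _.
      rewrite ltnS leq_mul2r; apply/orP; right; rewrite mnmE; exact/ltnW.
    apply: leq_trans (msizeXp _ _ _ yD) _.
    by rewrite ltnS leq_mul2r (ltnW (ltn_ord _)) orbT.
  by apply: (leq_trans h); rewrite /M /L; nia.
have big_row : (#|{: col}| < #|{: row}|)%N.
  rewrite card_prod !card_ffun !card_ord /M expnMn.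
  by rewrite ltn_pmul2l ?expn_gt0 // /n ltnSn.
have : kermx Mx != 0.
  rewrite kermx_eq0 /row_free; apply/negP => /eqP e.
  by have := rank_leq_col Mx; rewrite e leqNgt big_row.
case/rowV0Pn => u /sub_kermxP uM u0.
pose q : {poly R} := \sum_(t : row) (u 0 (enum_rank t) *: 'X_[mon t])%:P * 'X^(t.2).
have coefq (t : row) : (q`_(t.2))@_(mon t) = u 0 (enum_rank t).
  rewrite /q coef_sum raddf_sum (bigD1 t) //= coefCM coefXn eqxx mulr1.
  rewrite mcoeffZ mcoeffX eqxx mulr1 big1 ?addr0 // => t' t't.
  rewrite coefCM coefXn; case: eqP => [e2|_]; last by rewrite mulr0 mcoeff0.
  rewrite mulr1 mcoeffZ mcoeffX; case: eqP => [e1|_]; last by rewrite mulr0.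
  case/eqP: t't; rewrite [t']surjective_pairing [t]surjective_pairing; congr (_, _).
    apply/ffunP => i; apply/val_inj.
    by have := congr1 (fun mu : 'X_{1..m} => mu i) e1; rewrite !mnmE.
  exact: val_inj.
exists q.
  have [t ut] := rV0Pn _ u0; apply: contraNneq ut => q0.
  by rewrite -(enum_valK t) -coefq q0 coef0 mcoeff0.
have -> : (map_poly theta q).[y] = \sum_(t : row) u 0 (enum_rank t) *: P t.
  rewrite /q rmorph_sum horner_sum; apply: eq_bigr => t _.
  rewrite rmorphM /= map_polyC map_polyXn hornerM hornerC hornerXn /=.
  by rewrite -mul_mpolyC rmorphM /= thetaC -mulrA mul_mpolyC.
apply/mpolyP => mu; rewrite mcoeff0 raddf_sum /=.
case: (ltnP (mdeg mu) M) => muM; last first.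
  rewrite big1 // => t _; rewrite mcoeffZ memN_msupp_eq0 ?mulr0 //.
  exact/msize_mdeg_ge/(leq_trans (sizeP t)).
have lt i : (mu i < M)%N.
  by apply: leq_ltn_trans muM; rewrite mdegE (bigD1 i) //= leq_addr.
pose e : col := [ffun i => Ordinal (lt i)].
have := congr1 (fun v : 'rV[k]_ _ => v 0 (enum_rank e)) uM.
rewrite !mxE => h; rewrite -[RHS]h (reindex (@enum_rank row)) /=; last first.
  by exists (@enum_val row xpredT) => t _; rewrite ?enum_rankK ?enum_valK.
apply: eq_bigr => t _; rewrite mcoeffZ mxE !enum_rankK; congr (_ * mcoeff _ _).
by apply/mnmP => i; rewrite mnmE ffunE.
Qed.
End MonomialAlgebra.

(** * Divisors of monomials and automorphisms of k[T] *)

Section MonomialDivisors.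
Variables (k : fieldType) (m : nat).
Local Notation R := {mpoly k[m]}.
Implicit Types (p q : R) (mu nu : 'X_{1..m}).

Lemma mval_lowest p : p != 0 -> exists2 mu, mu \in msupp p &
  forall nu, nu \in msupp p -> gle (mval 0 mu) (mval 0 nu).
Proof.
by move=> p0; apply: gle_min_seq; rewrite msupp_eq0.
Qed.

Lemma mcoeff_lowest p q mu nu :
  (forall e, e \in msupp p -> gle (mval 0 mu) (mval 0 e)) ->
  (forall e, e \in msupp q -> gle (mval 0 nu) (mval 0 e)) ->
  (p * q)@_(mu + nu) = p@_mu * q@_nu.
Proof.
move=> hp hq; rewrite mcoeffM.
have lt1 (e1 e2 : 'X_{1..m}) : (mdeg e1 < (mdeg (e1 + e2)%MM).+1)%N by rewrite mdegD ltnS leq_addr.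
have lt2 (e1 e2 : 'X_{1..m}) : (mdeg e2 < (mdeg (e1 + e2)%MM).+1)%N by rewrite mdegD ltnS leq_addl.
rewrite (bigD1 (BMultinom (lt1 mu nu), BMultinom (lt2 mu nu))) //=.
rewrite big1 ?addr0 // => [[e1 e2]] /= /andP[/eqP e ne].
have [|z1] := boolP (val e1 \in msupp p); last by rewrite memN_msupp_eq0 // mul0r.
have [|z2] := boolP (val e2 \in msupp q); last by rewrite [q@__]memN_msupp_eq0 // mulr0.
move=> /hq h2 /hp h1; have := congr1 (mval 0) e; rewrite !(mvalD 0 0) => s.
have [e1E|lt] := gle_eqVlt h1; last first.
  by have := glt_leD lt h2; rewrite s glt_irr.
have e1' : mu = val e1 := (mval_inj e1E).2.
have e2' : nu = val e2.
  have /mval_inj[_ //] : mval 0 nu = mval 0 (val e2).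
  by move: s; rewrite -e1E => /addrI.
by case/eqP: ne; congr (_, _); apply: val_inj; rewrite /= -?e1' -?e2'.
Qed.

(** Highest and lowest monomials are additive in products. They coincide for p q, so they coincide
    for p. *)
Lemma monomial_divisor p q (c : k) mu : c != 0 -> p * q = c *: 'X_[mu] ->
  exists2 e, e != 0 & p = e *: 'X_[mlead p].
Proof.
move=> c0 pq.
have pq0 : p * q != 0.
  by rewrite pq scaler_eq0 negb_or c0 -msize_poly_eq0 msizeX.
have p0 : p != 0 by apply: contraNneq pq0 => ->; rewrite mul0r.
have q0 : q != 0 by apply: contraNneq pq0 => ->; rewrite mulr0.
have [lp lpp hp] := mval_lowest p0; have [lq lqq hq] := mval_lowest q0.
have top : (mlead p + mlead q)%MM = mu by rewrite -mleadM // pq mleadZ // mleadXm.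
have low : (lp + lq)%MM = mu.
  have : (p * q)@_(lp + lq) != 0.
    by rewrite mcoeff_lowest // mulf_neq0 // -mcoeff_msupp.
  apply: contraNeq => ne.
  by rewrite pq mcoeffZ mcoeffX [mu == _]eq_sym (negPf ne) mulr0.
have lpE : lp = mlead p.
  have [/mval_inj[_ //]|lt] := gle_eqVlt (hp _ (mlead_supp p0)).
  have := glt_leD lt (hq _ (mlead_supp q0)).
  by rewrite -!(mvalD 0 0) low top glt_irr.
exists p@_(mlead p); first by rewrite mleadc_eq0.
apply/mpolyP => nu; rewrite mcoeffZ mcoeffX.
have [->|ne] := eqVneq (mlead p) nu; first by rewrite mulr1.
rewrite mulr0 memN_msupp_eq0 //; apply: contraNN ne => nup.
have [/mval_inj[_]|lt] := gle_eqVlt (hp _ nup); first by rewrite lpE => ->.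
have := msupp_le_mlead nup => /(mval_le 0) le.
by have := gltNge lt; rewrite lpE => /(_ le).
Qed.
End MonomialDivisors.

Section MonomialAutomorphism.
Variables (k : fieldType) (m : nat).
Local Notation R := {mpoly k[m]}.

Lemma mlead_monoT (r : m.-tuple nat) i : (mlead (monoT k r)) i = tnth r i.
Proof.
rewrite /monoT (eq_bigr (fun i : 'I_m => 'X_[U_(i) *+ tnth r i] : R)) => [|l _].
  rewrite -(big_morph (@mpolyX m k) (@mpolyXD m k) (mpolyX0 m k)) mleadXm.
  rewrite mnm_sumE (bigD1 i) //= mulmnE mnm1E eqxx mul1n big1 ?addn0 // => l li.
  by rewrite mulmnE mnm1E (negPf li) mul0n.
by rewrite mpolyXn.
Qed.

Lemma monoTE (r : m.-tuple nat) : monoT k r = 1 *: 'X_[mlead (monoT k r)].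
Proof.
rewrite scale1r mpolyXE_id /monoT; apply: eq_bigr => i _.
by rewrite -/(monoT k r) mlead_monoT.
Qed.

Section OneSide.
Variables (theta : {rmorphism R -> R}) (r s : m.-tuple nat) (q : R).
Hypotheses (s_gt0 : forall i, (0 < tnth s i)%N)
  (theta_dvd : monoT k r = theta (monoT k s) * q).

(** As s_i > 0, theta T_i divides theta(T^s), hence divides the monomial T^r. *)
Lemma theta_monomial i : exists2 e, e != 0 & theta 'X_i = e *: 'X_[mlead (theta 'X_i)].
Proof.
apply: (@monomial_divisor _ _ _
  (theta ('X_i ^+ (tnth s i).-1 * \prod_(l | l != i) 'X_l ^+ tnth s l) * q) 1
  (mlead (monoT k r)) (oner_neq0 k)).
rewrite -monoTE theta_dvd mulrA -rmorphM mulrA -exprS prednK //.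
by rewrite /monoT [in RHS](bigD1 i).
Qed.

Lemma theta_exponent i l : (mlead (theta 'X_i) l * tnth s i <= tnth r l)%N.
Proof.
have t0 : theta (monoT k s) * q != 0 by rewrite -theta_dvd monoT_neq0.
have q0 : q != 0 by apply: contraNneq t0 => ->; rewrite mulr0.
have ts0 : theta (monoT k s) != 0 by apply: contraNneq t0 => ->; rewrite mul0r.
have x0 j : theta 'X_j != 0.
  have [e e0 ->] := theta_monomial j.
  by rewrite scaler_eq0 negb_or e0 -msize_poly_eq0 msizeX.
rewrite -[tnth r l](mlead_monoT r) theta_dvd mleadM // mnmDE.
apply: leq_trans (leq_addr _ _).
rewrite /monoT rmorph_prod (bigD1 i) //= mleadM; first 1 last.
- by rewrite rmorphXn expf_neq0.
- by apply/prodf_neq0 => j _; rewrite rmorphXn expf_neq0.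
by rewrite rmorphXn mleadX // mnmDE mulmnE leq_addr.
Qed.
End OneSide.

(** Each T_i goes to a nonconstant monomial up to a scalar, in both directions. Since theta' sends
    that monomial back to T_i, of degree 1, it is a single variable; [theta_exponent] applied both
    ways then equates the exponents. *)
Lemma monomial_perm (theta theta' : {rmorphism R -> R}) (r s : m.-tuple nat) (q q' : R) :
  (forall e, theta e%:MP = e%:MP) -> (forall e, theta' e%:MP = e%:MP) ->
  cancel theta theta' -> cancel theta' theta ->
  (forall i, (0 < tnth r i)%N) -> (forall i, (0 < tnth s i)%N) ->
  monoT k r = theta (monoT k s) * q -> monoT k s = theta' (monoT k r) * q' ->
  perm_eq r s.
Proof.
move=> tC t'C tK t'K r0 s0 dv dv'.
pose mu i := mlead (theta 'X_i); pose nu i := mlead (theta' 'X_i).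
have nu_neq0 i : nu i != 0%MM.
  have [e e0 eq] := theta_monomial r0 dv' i; apply/eqP => z; rewrite -/(nu i) z in eq.
  have := congr1 theta eq; rewrite t'K mpolyX0 -mul_mpolyC mulr1 tC.
  by move/(congr1 (@mmeasure _ _ mdeg)); rewrite msizeX mdeg1 msizeC e0.
have mu_neq0 i : mu i != 0%MM.
  have [e e0 eq] := theta_monomial s0 dv i; apply/eqP => z; rewrite -/(mu i) z in eq.
  have := congr1 theta' eq; rewrite tK mpolyX0 -mul_mpolyC mulr1 t'C.
  by move/(congr1 (@mmeasure _ _ mdeg)); rewrite msizeX mdeg1 msizeC e0.
have t'X l : theta' 'X_l != 0.
  have [e e0 ->] := theta_monomial r0 dv' l.
  by rewrite scaler_eq0 negb_or e0 -msize_poly_eq0 msizeX.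
have comp i : (\sum_l nu l *+ mu i l)%MM = U_(i)%MM.
  have [e e0 eq] := theta_monomial s0 dv i.
  have := congr1 theta' eq; rewrite tK -mul_mpolyC rmorphM t'C mul_mpolyC.
  move/(congr1 (@mlead _ _)); rewrite mleadXm mleadZ // mpolyXE_id rmorph_prod => ->.
  rewrite mlead_prod; last by move=> l _ _; rewrite rmorphXn expf_neq0.
  by apply: eq_bigr => l _; rewrite rmorphXn mleadX.
have mu1 i : exists l, mu i = U_(l)%MM.
  suff /mdeg1P : mdeg (mu i) == 1%N by case=> l /eqP ->; exists l.
  rewrite eqn_leq lt0n mdeg_eq0 mu_neq0 andbT.
  rewrite -(mdeg1 i) -comp mdeg_sum mdegE; apply: leq_sum => l _.
  by rewrite mdegMn leq_pmull // lt0n mdeg_eq0.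
have [sig sigE] := fin_all_exists mu1.
have nu_sig i : nu (sig i) = U_(i)%MM.
  rewrite -(comp i) sigE (bigD1 (sig i)) //= mnm1E eqxx mulm1n.
  rewrite big1 ?addm0 // => l li.
  by rewrite mnm1E eq_sym (negPf li) mulm0n.
have sig_inj : injective sig.
  move=> i l e; have := nu_sig i; rewrite e nu_sig => h.
  by have := congr1 (fun x : 'X_{1..m} => x i) h; rewrite !mnm1E eqxx; case: eqP.
rewrite perm_sym; apply/tuple_permP; exists (perm sig_inj); congr val.
apply: eq_from_tnth => i; rewrite tnth_mktuple permE; apply/eqP; rewrite eqn_leq.
have := theta_exponent s0 dv i (sig i); rewrite -/(mu i) sigE mnm1E eqxx mul1n => ->.
have := theta_exponent r0 dv' (sig i) i.
by rewrite -/(nu (sig i)) nu_sig mnm1E eqxx mul1n => ->.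
Qed.
End MonomialAutomorphism.

(** * The additive group action on B *)

Section ExponentialMap.
Variables (k : fieldType) (m d : nat) (a : 'I_d -> {mpoly k[m]}) (r : m.-tuple nat).
Local Notation R := {mpoly k[m]}.
Hypothesis d_gt1 : (1 < d)%N.
Let d_gt0 : (0 < d)%N := ltnW d_gt1.
Variables (A : comAlgType k) (c : {rmorphism R -> A}) (V U : A).
Hypothesis presA : presentation a r c V U.
Variables (K : fieldType) (j : {rmorphism R -> K}).
Hypothesis j_eq0 : forall p, (j p == 0) = (p == 0).
Local Notation tau := (monoT k r).

Lemma pres_ext (T : comNzRingType) (f g : {rmorphism A -> T}) :
  (forall z, f (c tau) * z = 0 -> z = 0) ->
  (forall p, f (c p) = g (c p)) -> f V = g V -> f =1 g.
Proof.
move=> reg fgc fgV; have fgU : f U = g U.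
  apply/eqP; rewrite -subr_eq0; apply/eqP/reg; apply/eqP.
  rewrite mulrBr subr_eq0 -rmorphM fgc -rmorphM (pres_rel presA) !rmorphD !rmorphXn fgV.
  rewrite !rmorph_sum; apply/eqP; congr (_ + _); apply: eq_bigr => i _.
  by rewrite !rmorphM !rmorphXn fgc fgV.
by apply: (pres_ind presA) => // x y hx hy; rewrite ?rmorphD ?rmorphM hx hy.
Qed.

Lemma tau_reg z : c tau * z = 0 -> z = 0.
Proof.
move/eqP; rewrite (pres_mulf_eq0 d_gt0 presA j_eq0) (c_eq0 d_gt0 presA j_eq0).
by rewrite (negPf (monoT_neq0 _ _)) => /eqP.
Qed.

Lemma tau_reg_poly (z : {poly A}) : (c tau)%:P * z = 0 -> z = 0.
Proof.
move=> e; apply/polyP => i; rewrite coef0; apply: tau_reg.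
by rewrite -coefCM e coef0.
Qed.

Lemma tau_reg_poly2 (z : {poly {poly A}}) : (c tau)%:P%:P * z = 0 -> z = 0.
Proof.
move=> e; apply/polyP => i; rewrite coef0; apply: tau_reg_poly.
by rewrite -coefCM e coef0.
Qed.

(** The increment of V is a multiple of T^r, so the Taylor expansion of F at V is divisible by T^r,
    and the quotient is the image of U. *)
Lemma exponential_exists : exists e : {rmorphism A -> {poly A}},
  (forall p, e (c p) = (c p)%:P) /\ e V = V%:P + (c tau)%:P * 'X.
Proof.
pose f : {rmorphism R -> {poly A}} := polyC \o c; pose h := (c tau)%:P * 'X : {poly A}.
have [H taylor] := evalV_taylor f V%:P h (Fpoly a).
pose u := U%:P + evalV f V%:P (Fpoly a)^`() * 'X + (c tau)%:P * 'X ^+ 2 * H.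
have [|g [gc gV _]] := pres_lift presA (f := f) (x := V%:P + h) (u := u).
  rewrite -evalV_Fpoly taylor.
  rewrite -(@evalV_morph _ _ _ _ c f (@polyC A)) // evalV_Fpoly -(pres_rel presA).
  by rewrite rmorphM /u /h /=; ring.
by exists g.
Qed.

Definition exponential := projT1 (boolp.cid exponential_exists).

Lemma exponential_c p : exponential (c p) = (c p)%:P.
Proof. by rewrite /exponential; case: boolp.cid => g [/= ->]. Qed.

Lemma exponential_V : exponential V = V%:P + (c tau)%:P * 'X.
Proof. by rewrite /exponential; case: boolp.cid => g [/= _ ->]. Qed.

Definition exp_hd n x := (exponential x)`_n.

(** The axiom of an action: applying it twice amounts to adding the two parameters, here the outer
    and the inner variable. *)
Lemma exponential_comp x : map_poly exponential (exponential x) =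
  (map_poly (polyC \o polyC) (exponential x)).['X + 'X%:P].
Proof.
pose f : {rmorphism A -> {poly {poly A}}} := map_poly exponential \o exponential.
pose g : {rmorphism A -> {poly {poly A}}} :=
  horner_eval ('X + 'X%:P) \o (map_poly (@polyC {poly A} \o @polyC A) \o exponential).
apply: (pres_ext (f := f) (g := g)) => [z|p|]; rewrite /= /horner_eval.
- by rewrite exponential_c map_polyC /= exponential_c; apply: tau_reg_poly2.
- by rewrite exponential_c !map_polyC /= exponential_c hornerC.
rewrite exponential_V !rmorphD !rmorphM /= !map_polyC !map_polyX /=.
rewrite hornerD hornerM !hornerC hornerX exponential_c exponential_V.
by rewrite rmorphD rmorphM /=; ring.
Qed.

(** Coefficients are compared in [exponential_comp]; expanding at the inner variable by divided
    derivatives produces the binomial. *)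
Lemma exp_hd_comp i l x : exp_hd i (exp_hd l x) = exp_hd (i + l) x *+ 'C(i + l, l).
Proof.
have -> : exp_hd i (exp_hd l x) = (map_poly exponential (exponential x))`_l`_i.
  by rewrite coef_map.
rewrite exponential_comp; set q := exponential x.
set N := maxn (size (map_poly (polyC \o polyC) q)) l.+1.
rewrite [_ + _]addrC (@nderiv_taylor_wide _ N) ?leq_maxl //; last exact: mulrC.
have nd n : (map_poly (@polyC {poly A} \o @polyC A) q)^`N(n).['X%:P] = (q^`N(n))%:P.
  rewrite nderivn_map map_poly_comp horner_map.
  by congr polyC; apply: comp_polyXr.
under eq_bigr do rewrite nd mul_polyC.
by rewrite -(poly_def N (fun n => q^`N(n))) coef_poly leq_maxr coef_nderivn addnC.
Qed.

Lemma exp_hd_higher_derivation : higher_derivation exp_hd.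
Proof.
split; rewrite /exp_hd.
- by move=> n x y; rewrite rmorphD coefD.
- move=> n x y; rewrite -mulr_algl rmorphM -(pres_const presA) exponential_c coefCM.
  by rewrite (pres_const presA) mulr_algl.
- by move=> n x y; rewrite rmorphM coefM.
- move=> x; rewrite -horner_coef0.
  pose f : {rmorphism A -> A} := horner_eval 0 \o exponential.
  apply: (pres_ext (f := f) (g := idfun)) => [z|p|] /=; rewrite /horner_eval.
  + by rewrite exponential_c hornerC; apply: tau_reg.
  + by rewrite exponential_c hornerC.
  by rewrite exponential_V hornerD hornerM !hornerC hornerX mulr0 addr0.
- by move=> n n0; rewrite rmorph1 coef1 gtn_eqF.
- exact: exp_hd_comp.
move=> x; exists (size (exponential x)) => l; exact: nth_default.
Qed.

Lemma exp_hd_c n p : (0 < n)%N -> exp_hd n (c p) = 0.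
Proof. by move=> n0; rewrite /exp_hd exponential_c coefC gtn_eqF. Qed.

Lemma exp_hd_V : exp_hd 1 V != 0.
Proof.
rewrite /exp_hd exponential_V coefD coefC add0r coefMX coefC /=.
by rewrite (c_eq0 d_gt0 presA j_eq0) monoT_neq0.
Qed.
End ExponentialMap.

(** * Effect of an isomorphism on k[T], V and U *)

Section Isomorphism.
Variables (k : fieldType) (m d : nat) (a : 'I_d -> {mpoly k[m]}).
Local Notation R := {mpoly k[m]}.
Hypothesis d_gt1 : (1 < d)%N.
Let d_gt0 : (0 < d)%N := ltnW d_gt1.
Variables (K : fieldType) (j : {rmorphism R -> K}).
Hypothesis j_eq0 : forall p, (j p == 0) = (p == 0).

Section OneDirection.
Variables (r s : m.-tuple nat).
Variables (A : comAlgType k) (c : {rmorphism R -> A}) (V U : A).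
Hypothesis presA : presentation a r c V U.
Variables (A' : comAlgType k) (c' : {rmorphism R -> A'}) (V' U' : A').
Hypothesis presA' : presentation a s c' V' U'.
Variables (g : {rmorphism A' -> A}) (h : {rmorphism A -> A'}).
Hypotheses (gK : cancel g h) (hK : cancel h g) (gC : forall e, g (e%:A) = e%:A).
Local Notation iotaA := (iota presA j_eq0).

Lemma hC e : h (e%:A) = e%:A.
Proof. by rewrite -(gC e) gK. Qed.

Lemma g_scale e x : g (e *: x) = e *: g x.
Proof. by rewrite -mulr_algl rmorphM gC mulr_algl. Qed.

Lemma h_scale e x : h (e *: x) = e *: h x.
Proof. by rewrite -mulr_algl rmorphM hC mulr_algl. Qed.

(** The action on A' is conjugated into a nontrivial one on A; the image of k[T] is fixed by it,
    hence lies in k[T]. *)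
Lemma coefs_into_coefs : (forall i, (1 < tnth r i)%N) -> forall p, exists p', g (c' p) = c p'.
Proof.
move=> r1 p; pose D n x := g (exp_hd presA' n (h x)).
have Dhd := exp_hd_higher_derivation d_gt1 presA' j_eq0.
have DD : higher_derivation D.
  split; rewrite /D.
  - by move=> n x y; rewrite rmorphD (hd_add Dhd) rmorphD.
  - by move=> n e x; rewrite h_scale (hd_scale Dhd) g_scale.
  - move=> n x y; rewrite rmorphM (hd_mul Dhd) rmorph_sum.
    by apply: eq_bigr => i _; rewrite rmorphM.
  - by move=> x; rewrite (hd_id Dhd) hK.
  - by move=> n n0; rewrite rmorph1 (hd_one Dhd) // rmorph0.
  - by move=> i l x; rewrite gK (hd_comp Dhd) rmorphMn.
  move=> x; have [n hn] := hd_fin Dhd (h x); exists n => l nl.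
  by rewrite hn // rmorph0.
apply: (fixed_in_coefs d_gt1 presA j_eq0 DD r1).
  exists (g V'), 1%N; split=> //; rewrite /D gK.
  apply: contraNneq (exp_hd_V d_gt1 presA' j_eq0) => e.
  by rewrite -[exp_hd _ _ _]gK e rmorph0.
by move=> n n0; rewrite /D gK exp_hd_c // rmorph0.
Qed.

Section WithTheta.
Variable theta : {rmorphism R -> R}.
Hypothesis thetaE : forall p, g (c' p) = c (theta p).

Lemma theta_const e : theta e%:MP = e%:MP.
Proof.
apply: (c_inj d_gt0 presA j_eq0).
by rewrite -thetaE (pres_const presA') gC (pres_const presA).
Qed.

Lemma theta_inj : injective theta.
Proof.
move=> p q e; apply: (c_inj d_gt0 presA' j_eq0); apply: (can_inj gK).
by rewrite !thetaE e.
Qed.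

(** p is algebraic over theta(k[T]), so h (c p) is algebraic over k[T] in A'. An element of positive
    degree in V' would be transcendental, since composition with a nonconstant polynomial kills no
    nonzero one. *)
Lemma coefs_onto_coefs p : exists p', h (c p) = c' p'.
Proof.
have [q q0 qz] := algebraic_dependence p theta_const.
pose y := h (c p).
apply: (size_iota_le1 d_gt0 (presA := presA') (j_eq0 := j_eq0)); rewrite -/y.
rewrite leqNgt; apply/negP => sy; case/eqP: (q0).
have e1 : (map_poly c' q).[y] = 0.
  apply: (can_inj gK); rewrite rmorph0 -horner_map /y hK -map_poly_comp.
  rewrite (eq_map_poly thetaE) (map_poly_comp c theta) horner_map.
  by rewrite qz rmorph0.
have := congr1 (iota presA' j_eq0) e1; rewrite rmorph0 -horner_map -map_poly_comp.
rewrite (eq_map_poly (g := polyC \o j)) => [|x /=]; last by rewrite iota_c.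
rewrite map_poly_comp => /eqP; rewrite comp_poly_eq0 // => /eqP e.
apply/polyP => i; rewrite coef0; apply/eqP; rewrite -j_eq0 -coef_map e coef0 //.
Qed.

Lemma iota_g n q x : c' (monoT k s) ^+ n * x = (map_poly c' q).[V'] ->
  j (theta (monoT k s)) ^+ n *: iotaA (g x) = (map_poly (j \o theta) q) \Po iotaA (g V').
Proof.
move=> /(congr1 (iotaA \o g)) /=; rewrite !rmorphM !rmorphXn /= thetaE iota_c.
rewrite -polyC_exp mul_polyC => ->; rewrite -!horner_map -!map_poly_comp /comp_poly.
rewrite -map_poly_comp; congr (_.[_]); apply: eq_map_poly => y /=.
by rewrite thetaE iota_c.
Qed.

Lemma jtheta_inj : injective (j \o theta).
Proof.
apply: inj_comp theta_inj => p q /eqP; rewrite -subr_eq0 -rmorphB j_eq0 subr_eq0.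
by move/eqP.
Qed.

Lemma jtheta_tau_neq0 n : j (theta (monoT k s)) ^+ n != 0.
Proof.
rewrite expf_neq0 // j_eq0 -(rmorph0 theta) (inj_eq theta_inj); exact: monoT_neq0.
Qed.

(** Up to a nonzero constant of K, V is a polynomial in g V'. Degrees multiply under composition, so
    that of g V' divides 1. *)
Lemma size_iota_gV : size (iotaA (g V')) = 2%N.
Proof.
have [n [q e]] := denom presA' (h V).
have := congr1 (fun p : {poly K} => (size p).-1) (iota_g e).
rewrite hK iota_V size_scale ?jtheta_tau_neq0 // size_polyX size_comp_poly.
set w := size (iotaA _) => /esym/eqP; rewrite muln_eq1 => /andP[_].
by case: w => [|[|[]]].
Qed.

Lemma gV_affine : exists lam mu, g V' = c lam * V + c mu /\ lead_coef (iotaA (g V')) = j lam.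
Proof.
have [b gV] := NF_surj d_gt0 presA (g V').
have [sb lb] := iota_NF presA j_eq0 b; rewrite -gV size_iota_gV in sb lb.
exists b`_1, b`_0; split.
  rewrite gV /NF -sb big_ord_recl big_ord1 /= !UV_small // expr0 expr1 mulr1.
  by rewrite addrC.
by rewrite lb -sb /= divn_small // expr0 invr1 mulr1 lead_coefE -sb.
Qed.
(** The leading coefficient of g U' is read twice: lam^d / theta(T^s) from the relation of A', and
    an element of k[T] over T^r from the normal form in A. *)
Lemma theta_tau_dvd lam lam' : lam * lam' = 1 -> lead_coef (iotaA (g V')) = j lam ->
  exists q, monoT k r = theta (monoT k s) * q.
Proof.
move=> lamK leadV; have sV := size_iota_gV.
have rel : c' (monoT k s) ^+ 1 * U' = (map_poly c' (Fpoly a)).[V'].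
  by rewrite expr1 (pres_rel presA') -evalV_Fpoly.
have [sF lF] := size_lead_Fpoly a.
have e := iota_g rel; rewrite expr1 in e.
have jt0 : j (theta (monoT k s)) != 0 by have := jtheta_tau_neq0 1; rewrite expr1.
have jt_inj := jtheta_inj; have jt_0 : (j \o theta) 0 = 0 by rewrite rmorph0.
have sU : (size (iotaA (g U'))).-1 = d.
  have := congr1 (fun p : {poly K} => (size p).-1) e.
  rewrite size_scale // size_comp_poly sV muln1 => ->.
  by rewrite (size_map_inj_poly jt_inj jt_0) sF.
have lU : j (theta (monoT k s)) * lead_coef (iotaA (g U')) = j lam ^+ d.
  rewrite -lead_coefZ e lead_coef_comp ?sV // leadV.
  rewrite (lead_coef_map_inj jt_inj jt_0) (size_map_inj_poly jt_inj jt_0) sF lF.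
  by rewrite rmorph1 mul1r.
have [b gU] := NF_surj d_gt0 presA (g U').
have [sb lb] := iota_NF presA j_eq0 b; rewrite -gU in sb lb.
exists (lead_coef b * lam' ^+ d).
have jr0 := jtau_neq0 r j_eq0.
have main : theta (monoT k s) * lead_coef b = lam ^+ d * monoT k r.
  apply: (j_inj j_eq0); rewrite !rmorphM rmorphXn /= -lU lb -sb sU divnn d_gt0 expr1.
  by rewrite -!mulrA mulVf // mulr1.
by rewrite mulrA main mulrAC -exprMn lamK expr1n mul1r.
Qed.
End WithTheta.
End OneDirection.

Lemma theta_exists (A A' : comAlgType k) (c : {rmorphism R -> A}) (c' : {rmorphism R -> A'})
  (g : {rmorphism A' -> A}) : (forall e, g (c' e%:MP) = c e%:MP) ->
  (forall i, exists p, g (c' 'X_i) = c p) ->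
  exists theta : {rmorphism R -> R}, forall p, g (c' p) = c (theta p).
Proof.
move=> gC /fin_all_exists[x gX]; exists (mmap (@mpolyC m k) x).
apply: (mpoly_morph_ext (f := g \o c') (g := c \o mmap (@mpolyC m k) x)) => [e|i] /=.
  by rewrite mmapC.
by rewrite mmapX mmap1U.
Qed.

Lemma isomorphic_perm (r s : m.-tuple nat)
  (A : comAlgType k) (c : {rmorphism R -> A}) (V U : A)
  (A' : comAlgType k) (c' : {rmorphism R -> A'}) (V' U' : A') :
  presentation a r c V U -> presentation a s c' V' U' ->
  (forall i, (1 < tnth r i)%N) -> (forall i, (0 < tnth s i)%N) ->
  alg_isomorphic A A' -> perm_eq r s.
Proof.
move=> presA presA' r1 s0 [h0 [g0 gh hg]]; pose h : {rmorphism A -> A'} := h0.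
pose g : {rmorphism A' -> A} := HB.pack g0
  (GRing.isZmodMorphism.Build _ _ g0 (can2_zmod_morphism gh hg))
  (GRing.isMonoidMorphism.Build _ _ g0 (can2_monoid_morphism gh hg)).
have gK : cancel g h := hg; have hK : cancel h g := gh.
have hC e : h (e%:A) = e%:A by rewrite /h /= linearZ rmorph1.
have gC e : g (e%:A) = e%:A by rewrite -[in LHS]hC hK.
have [theta thetaE] : exists theta : {rmorphism R -> R}, forall p, g (c' p) = c (theta p).
  apply: theta_exists => [e|i].
    by rewrite (pres_const presA') gC (pres_const presA).
  exact: (coefs_into_coefs presA presA' gK hK gC r1).
have [theta' theta'E] : exists theta' : {rmorphism R -> R}, forall p, h (c p) = c' (theta' p).
  apply: theta_exists => [e|i].
    by rewrite (pres_const presA) hC (pres_const presA').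
  exact: (coefs_onto_coefs presA presA' gK hK gC thetaE).
have thK : cancel theta theta'.
  by move=> p; apply: (c_inj d_gt0 presA' j_eq0); rewrite -theta'E -thetaE gK.
have th'K : cancel theta' theta.
  by move=> p; apply: (c_inj d_gt0 presA j_eq0); rewrite -thetaE -theta'E hK.
have [lam [mu [gV lV]]] := gV_affine presA presA' gK hK thetaE.
have [lam' [mu' [hV lV']]] := gV_affine presA' presA hK gK theta'E.
(* Compare the coefficients of V in g (h V) = V. *)
have lamK : theta lam' * lam = 1.
  have := congr1 (iota presA j_eq0) (hK V).
  rewrite hV !(rmorphD, rmorphM) gV !thetaE !(rmorphD, rmorphM) !iota_c iota_V.
  move=> /(congr1 (fun p : {poly K} => p`_1)).
  rewrite coefD coefCM coefD coefCM coefX !coefC /= mulr1 !addr0 -rmorphM.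
  by rewrite -(rmorph1 j) => /(j_inj j_eq0).
have lamK' : lam * theta lam' = 1 by rewrite mulrC.
have lam'K : lam' * theta' lam = 1.
  by rewrite -[lam']thK -rmorphM lamK rmorph1.
have [q dv] := theta_tau_dvd presA' gK hK thetaE lamK' lV.
have [q' dv'] := theta_tau_dvd presA hK gK theta'E lam'K lV'.
apply: (monomial_perm _ _ thK th'K _ s0 dv dv') => [e|e|i].
- exact: (theta_const presA presA' gC thetaE).
- exact: (theta_const presA' presA hC theta'E).
exact: ltnW.
Qed.
End Isomorphism.

Lemma B_isomorphic_perm (k : fieldType) (m d : nat) (a : 'I_d -> {mpoly k[m]})
  (r s : m.-tuple nat) : (1 < d)%N ->
  all (fun e => 1 < e)%N r -> all (fun e => 0 < e)%N s ->
  alg_isomorphic (B a r) (B a s) -> perm_eq r s.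
Proof.
move=> d1 /all_tnthP r1 /all_tnthP s0.
exact: (isomorphic_perm d1 (@tofrac_eq0 _) (B_presentation a r) (B_presentation a s)).
Qed.

Theorem theoremB (k : fieldType) (m d : nat) (hm : (0 < m)%N) (hd : (1 < d)%N)
    (a : 'I_d -> {mpoly k[m]}) :
  (forall r s : m.-tuple nat,
      all (fun e => 0 < e)%N r -> all (fun e => 0 < e)%N s ->
      (all (fun e => 1 < e)%N r /\ ~ all (fun e => 1 < e)%N s) \/
      (all (fun e => 1 < e)%N r /\ all (fun e => 1 < e)%N s /\
       ~ perm_eq r s) ->
      ~ alg_isomorphic (B a r) (B a s)) /\
  (generate_unit_ideal (polyF a) (polyF' a) ->
   forall r s : m.-tuple nat,
      all (fun e => 0 < e)%N r -> all (fun e => 0 < e)%N s ->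
      alg_isomorphic (poly1 (B a r)) (poly1 (B a s))).
Proof.
split=> [r s _ s0 rs iso|unitF r s r0 s0]; last exact: stable_isomorphic (ltnW hd) _ _ _.
have [r1 [s1|[_ rs']]] : all (fun e => 1 < e)%N r /\
    (~ all (fun e => 1 < e)%N s \/ all (fun e => 1 < e)%N s /\ ~ perm_eq r s).
- by case: rs => [[-> ?]|[-> ?]]; split=> //; [left | right].
- by apply: s1; rewrite -(perm_all _ (B_isomorphic_perm hd r1 s0 iso)).
exact/rs'/(B_isomorphic_perm hd r1 s0 iso).
Qed.
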